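(* For every $c>0$ there exist constants $C=C(c)>0$ and $\gamma=\gamma(c)>0$ such that the following holds. Let $G$ be an $n$-vertex $(p,\beta)$-bijumbled graph and let $\rho=\rho(n)\in(0,1]$ satisfy $$\delta(G)\ge cpn,\quad \beta\le\gamma pn,\quad \rho pn\ge C(\log n)^2,\quad\text{and}\quad 2\mid n.$$ Then the family of perfect matchings of $G$ supports a $C\log n/(pn)$-spread measure. Moreover, following an $[n/2]$-uniform colouring of $G$, the percolation $G_\rho$ a.a.s. admits a rainbow perfect matching.
   Context: All graphs are finite and simple; $\delta(G)$ is the minimum degree; $\log$ is the natural logarithm. For a graph $G$ and $X,Y\subseteq V(G)$ put $\vec e_G(X,Y)=|\{(x,y)\in X\times Y: xy\in E(G)\}|$. For $0<p\le1$ and $\beta\ge0$, $G$ is $(p,\beta)$-bijumbled if $|\vec e_G(X,Y)-p|X||Y||\le\beta\sqrt{|X||Y|}$ for all $X,Y\subseteq V(G)$. For a finite set $\Omega$ and $S\subseteq\Omega$ write $\langle S\rangle=\{A\subseteq\Omega:S\subseteq A\}$. For $q>0$, a probability measure $\mu$ on $2^\Omega$ is $q$-spread if $\mu(\langle S\rangle)\le q^{|S|}$ for every $S\subseteq\Omega$; a family $\mathcal A\subseteq2^\Omega$ supports such a measure if $\mu(\mathcal A)=1$. Here $\Omega=E(G)$ and a perfect matching is identified with its edge-set. A $[Q]$-uniform colouring of a graph assigns to each edge, independently, a colour chosen uniformly at random from $[Q]=\{1,\dots,Q\}$. A subgraph is rainbow if all its edges receive distinct colours. $G_\rho$ is the random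 spanning subgraph of $G$ obtained by retaining each edge independently with probability $\rho$, independently of the colouring; the probability is over both the colouring and the percolation. Asymptotics are as $n\to\infty$: $p,\beta,\rho$ may depend on $n$, $G=G_n$ is any sequence of graphs satisfying the hypotheses, and a.a.s. means with probability tending to $1$ as $n\to\infty$. *)

(* Defs.v *)
From HB Require Import structures.
From mathcomp Require Import all_boot all_order all_algebra.
From mathcomp Require Import all_classical all_reals all_analysis.

Set Implicit Arguments.
Unset Strict Implicit.
Unset Printing Implicit Defensive.

Import Order.TTheory GRing.Theory Num.Theory.

Local Open Scope ring_scope.

Record sgraph := SGraph {
  vertex :> finType;
  adj : rel vertex;
  adj_sym : symmetric adj;
  adj_irr : irreflexive adj }.

Section Graphs.
Variable G : sgraph.

Definition edge_set : {set {set G}} :=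
  [set e : {set G} | [exists x : G, exists y : G, adj x y && (e == [set x; y])]].

(* The ground set E(G) as a finite type, so that {set edge} is 2^E(G). *)
Definition edge : finType := {e : {set G} | e \in edge_set}.

Definition degree (v : G) : nat := #|[set w : G | adj v w]|.

(* Every degree is below #|G|, so the initial value #|G| never contributes
   when G has a vertex. *)
Definition min_degree : nat := \big[minn/#|G|]_(v : G) degree v.

(* Ordered pairs: an edge inside X :&: Y is counted twice. *)
Definition dir_edges (X Y : {set G}) : nat :=
  #|[set xy : G * G | [&& xy.1 \in X, xy.2 \in Y & adj xy.1 xy.2]]|.

Definition perfect_matching (M : {set edge}) : bool :=
  [forall v : G, #|[set e in M | v \in val e]| == 1%N].

Definition perfect_matchings : {set {set edge}} :=
  [set M | perfect_matching M].

Definition rainbow (Q : nat) (chi : {ffun edge -> 'I_Q}) (M : {set edge}) : bool :=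
  [forall e in M, forall f in M, (chi e == chi f) ==> (e == f)].

End Graphs.

Definition bijumbled (R : realType) (G : sgraph) (p beta : R) : Prop :=
  [/\ 0 < p <= 1, 0 <= beta &
    forall X Y : {set G},
      `|(dir_edges X Y)%:R - p * #|X|%:R * #|Y|%:R|
        <= beta * Num.sqrt (#|X|%:R * #|Y|%:R)].

Section FiniteProbability.
Variable R : realType.

Definition is_pmf (T : finType) (mu : T -> R) : Prop :=
  (forall x, 0 <= mu x) /\ \sum_(x : T) mu x = 1.

Definition Prob (T : finType) (mu : T -> R) (A : {set T}) : R :=
  \sum_(x in A) mu x.

Definition upset (Omega : finType) (S : {set Omega}) : {set {set Omega}} :=
  [set A : {set Omega} | S \subset A].

Definition spread (Omega : finType) (q : R) (mu : {set Omega} -> R) : Prop :=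
  forall S : {set Omega}, Prob mu (upset S) <= q ^+ #|S|.

Definition supports_spread (Omega : finType) (q : R)
    (F : {set {set Omega}}) : Prop :=
  0 < q /\
  exists mu : {set Omega} -> R, [/\ is_pmf mu, spread q mu & Prob mu F = 1].

(* An outcome is a pair (colouring, set of retained edges); its probability is
   a product over edges, each edge having a uniform colour in 'I_Q and being
   retained with probability rho, all these choices independent. *)
Definition colour_percolation (E : finType) (Q : nat) (rho : R)
    (w : {ffun E -> 'I_Q} * {set E}) : R :=
  (\prod_(e : E) Q%:R^-1) *
  \prod_(e : E) (if e \in w.2 then rho else 1 - rho).

Lemma colour_percolation_pmf (E : finType) (Q : nat) (rho : R) :
  (0 < Q)%N -> 0 <= rho <= 1 -> is_pmf (@colour_percolation E Q rho).
Proof.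
move=> Q0 /andP[r0 r1]; split=> [w|].
  apply: mulr_ge0; apply: prodr_ge0 => e _; first by rewrite invr_ge0 ler0n.
  by case: ifP; rewrite ?subr_ge0.
have sumS :
    \sum_(S : {set E}) \prod_(e : E) (if e \in S then rho else 1 - rho) = 1.
  transitivity (\prod_(e : E) (rho + (1 - rho))).
    by rewrite bigA_distr.
  by rewrite big1// => e _; rewrite addrC subrK.
rewrite -(pair_bigA _ (fun chi S => @colour_percolation E Q rho (chi, S))) /=.
rewrite /colour_percolation /=.
under eq_bigr do rewrite -mulr_sumr sumS mulr1.
rewrite sumr_const card_ffun card_ord prodr_const -[LHS]mulr_natr natrX.
by rewrite -exprMn mulVf ?expr1n// pnatr_eq0 -lt0n.
Qed.

End FiniteProbability.

Definition has_rainbow_pm (G : sgraph) (Q : nat) :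
    {set {ffun edge G -> 'I_Q} * {set edge G}} :=
  [set w : {ffun edge G -> 'I_Q} * {set edge G} |
    [exists M : {set edge G},
      [&& perfect_matching M, M \subset w.2 & rainbow w.1 M]]].

Definition admissible (R : realType) (c C gamma : R)
    (G : sgraph) (p beta rho : R) : Prop :=
  let n := #|G| in
  [/\ (0 < n)%N, (2 %| n)%N, bijumbled G p beta, 0 < rho <= 1 &
   [/\ c * p * n%:R <= (min_degree G)%:R,
       beta <= gamma * p * n%:R &
       C * ln n%:R ^+ 2 <= rho * p * n%:R]].

(* Main.v *)
(** With [n = #|G|] and [L = ln n], percolate [G] with density [r] of order
    [L / (p n)].  A random balanced bipartition [U], [~: U] keeps a constant
    fraction of every degree on both sides; by bijumbledness any [X] in [U] and
    [Z] in [~: U] with [#|X| + #|Z| > n / 2] span at least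
    [c / 10 * p * n * minn #|X| #|Z|] edges, so a union bound over the
    obstructions to Hall's condition shows that the percolated bipartite graph
    has a perfect matching with probability at least [1/2].  The conditional law
    of that matching is [2 r]-spread.

    Colouring a matching of this law by a uniformly random bijection onto the
    [n / 2] colours gives a spread measure on sets of pairs (edge, colour).  The
    minimum-fragment argument of Park and Pham (in the spread setting of
    Frankston, Kahn, Narayanan and Park) is then run on random partial
    colourings: about [log2 n] rounds of density of order [r] halve the
    uncovered part of a typical member, and one last round of density of order
    [r L] covers what remains.  McDiarmid's coupling merges the rounds into a
    single coloured percolation. *)
Require Import Defs.
From mathcomp Require Import all_classical all_reals all_analysis.
From mathcomp Require Import all_boot all_order all_fingroup all_algebra.
From mathcomp Require Import ring lra zify.

Set Implicit Arguments.
Unset Strict Implicit.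
Unset Printing Implicit Defensive.

Import Order.TTheory GRing.Theory Num.Theory.

Local Open Scope ring_scope.

(** * Product measures *)

Section Products.
Variables (R : realFieldType) (E : finType).

Lemma ler_sum_subset (I : finType) (P Q : pred I) (F : I -> R) :
  (forall i, 0 <= F i) -> (forall i, P i -> Q i) ->
  \sum_(i | P i) F i <= \sum_(i | Q i) F i.
Proof.
move=> F0 PQ; rewrite big_mkcond [leRHS]big_mkcond; apply: ler_sum => i _.
by case: (boolP (P i)) => [/PQ ->//|_]; case: ifP.
Qed.

Definition prodw (D : finType) (nu : D -> R) (W : {ffun E -> D}) : R :=
  \prod_e nu (W e).

Lemma prodw_ge0 (D : finType) (nu : D -> R) W :
  (forall d, 0 <= nu d) -> 0 <= prodw nu W.
Proof. by move=> nu0; apply: prodr_ge0. Qed.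

Lemma sum_prodw (D : finType) (nu : D -> R) :
  \sum_d nu d = 1 -> \sum_W prodw nu W = 1.
Proof.
move=> nu1; rewrite -(bigA_distr_bigA (fun=> nu)) /=.
by rewrite big1// => e _.
Qed.

Lemma sum_prodw_pair (A B : finType) (a : A -> R) (b : B -> R)
    (g : {ffun E -> A * B} -> R) :
  \sum_W prodw (fun d => a d.1 * b d.2) W * g W =
  \sum_u \sum_v prodw a u * prodw b v * g [ffun e => (u e, v e)].
Proof.
rewrite pair_bigA /=.
rewrite (reindex (fun p : {ffun E -> A} * {ffun E -> B} =>
  [ffun e => (p.1 e, p.2 e)])) /=.
  apply: eq_bigr => -[u v] _ /=; congr (_ * _).
  rewrite -big_split; apply: eq_bigr => e _ /=; by rewrite ffunE.
exists (fun W => ([ffun e => (W e).1], [ffun e => (W e).2])) => [[u v]|W] _ /=.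
  by congr pair; apply/ffunP => e; rewrite !ffunE.
by apply/ffunP => e; rewrite !ffunE /=; case: (W e).
Qed.

Definition upd (D : finType) (W : {ffun E -> D}) e d : {ffun E -> D} :=
  [ffun i => if i == e then d else W i].

(** Exchanging the coordinate at [e] with the fresh value [d] is an involution of the pairs
    [(W, d)]. After the exchange the discarded coordinate has law [F e] and sums out to 1, so the
    law at [e] has become [nu]. *)
Lemma resample (D : finType) (F : E -> D -> R) (nu : D -> R) e
    (f : {ffun E -> D} -> R) : \sum_d F e d = 1 ->
  \sum_(W : {ffun E -> D}) (\prod_i F i (W i)) * (\sum_d nu d * f (upd W e d)) =
  \sum_(W : {ffun E -> D}) (\prod_i (if i == e then nu else F i) (W i)) * f W.
Proof.
move=> Fe1.
transitivity (\sum_(W : {ffun E -> D}) \sum_d ((\prod_i F i (W i)) * nu d * f (upd W e d))).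
  by apply: eq_bigr => W _; rewrite mulr_sumr; apply: eq_bigr => d _; rewrite mulrA.
pose sw (p : {ffun E -> D} * D) := (upd p.1 e p.2, p.1 e).
have swK : involutive sw.
  case=> W d; rewrite /sw /upd /= ffunE eqxx; congr pair.
  by apply/ffunP => i; rewrite !ffunE; case: eqP => // ->.
rewrite pair_bigA /= (reindex_inj (inv_inj swK)) /= -(pair_bigA _ (fun W d =>
  (\prod_i F i (upd W e d i)) * nu (W e) * f (upd (upd W e d) e (W e)))) /=.
apply: eq_bigr => W _.
transitivity (\sum_d F e d * ((\prod_i (if i == e then nu else F i) (W i)) * f W)).
  apply: eq_bigr => d _.
  have -> : upd (upd W e d) e (W e) = W.
    by apply/ffunP => i; rewrite !ffunE; case: eqP => // ->.
  rewrite (bigD1 e)//= [in RHS](bigD1 e)//= !ffunE eqxx.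
  rewrite (eq_bigr (fun i => F i (W i))); last first.
    by move=> i /negbTE ie; rewrite ffunE ie.
  rewrite [X in _ = _ * (_ * X * _)](eq_bigr (fun i => F i (W i))); last first.
    by move=> i /negbTE ie; rewrite ie.
  ring.
by rewrite -mulr_suml Fe1 mul1r.
Qed.

(* Lindeberg-style replacement of one coordinate at a time. *)
Lemma prodw_le (D : finType) (nu nu' : D -> R) (f : {ffun E -> D} -> R) :
  (forall d, 0 <= nu d) -> (forall d, 0 <= nu' d) ->
  \sum_d nu d = 1 -> \sum_d nu' d = 1 ->
  (forall W e, \sum_d nu d * f (upd W e d) <= \sum_d nu' d * f (upd W e d)) ->
  \sum_W prodw nu W * f W <= \sum_W prodw nu' W * f W.
Proof.
move=> nu0 nu'0 nu1 nu'1 le1.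
(* Hybrid law: coordinates listed in [s] already follow [nu']. A repeated entry is harmless, since
   it replaces [nu'] by itself. *)
pose mu (s : seq E) i := if i \in s then nu' else nu.
suff H s : \sum_W prodw nu W * f W <= \sum_(W : {ffun E -> D}) (\prod_i mu s i (W i)) * f W.
  apply: le_trans (H (enum E)) _; rewrite le_eqVlt; apply/orP; left; apply/eqP.
  apply: eq_bigr => W _; congr (_ * _); apply: eq_bigr => i _.
  by rewrite /mu mem_enum.
elim: s => [//|e s /le_trans]; apply.
have mu_ge0 i d : 0 <= mu s i d by rewrite /mu; case: ifP.
have mu_sum i : \sum_d mu s i d = 1 by rewrite /mu; case: ifP.
have -> : \sum_(W : {ffun E -> D}) (\prod_i mu (e :: s) i (W i)) * f W =
    \sum_(W : {ffun E -> D}) (\prod_i mu s i (W i)) * (\sum_d nu' d * f (upd W e d)).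
  rewrite resample//; apply: eq_bigr => W _; congr (_ * _).
  by apply: eq_bigr => i _; rewrite /mu inE; case: eqP.
have -> : \sum_(W : {ffun E -> D}) (\prod_i mu s i (W i)) * f W =
    \sum_(W : {ffun E -> D}) (\prod_i mu s i (W i)) * (\sum_d mu s e d * f (upd W e d)).
  rewrite resample//; apply: eq_bigr => W _; congr (_ * _).
  by apply: eq_bigr => i _; case: eqP => // ->.
apply: ler_sum => W _; apply: ler_wpM2l; first exact: prodr_ge0.
by rewrite /mu; case: ifP.
Qed.
End Products.

(** * Random partial colourings *)

Section PartialColourings.
Variables (R : realFieldType) (E K : finType).

Definition colw (r : R) (o : option K) : R :=
  if o is Some _ then r / #|K|%:R else 1 - r.

(** A partial colouring seen as a subset of the ground set [E * K]: it contains a set of pairs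
    exactly when each edge concerned is retained with the prescribed colour. *)
Definition graph_of (W : {ffun E -> option K}) : {set E * K} :=
  [set x | W x.1 == Some x.2].

Definition hits (I : finType) (P : pred I) (S : I -> {set E * K}) (X : {set E * K}) : bool :=
  [exists i, P i && (S i \subset X)].

Lemma hitsS (I : finType) (P : pred I) (S : I -> {set E * K})
    (X Y : {set E * K}) : X \subset Y -> hits P S X -> hits P S Y.
Proof.
move=> XY /existsP[i /andP[Pi SX]]; apply/existsP; exists i.
by rewrite Pi (subset_trans SX).
Qed.

Lemma colw_ge0 r d : 0 <= r <= 1 -> 0 <= colw r d.
Proof.
by case/andP=> r0 r1; case: d => [c|]/=; rewrite ?subr_ge0// divr_ge0.
Qed.

Lemma big_option (g : option K -> R) : \sum_d g d = g None + \sum_c g (Some c).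
Proof.
rewrite (bigD1 None)//=; congr (_ + _).
rewrite (reindex_omap Some id)/=; last by case.
by apply: eq_bigl => i; rewrite eqxx.
Qed.

Lemma sum_colw r : (0 < #|K|)%N -> \sum_d colw r d = 1.
Proof.
move=> K0; rewrite big_option /= sumr_const -(mulr_natr (r / _)) divfK ?subrK//.
by rewrite pnatr_eq0 -lt0n.
Qed.

Lemma sum_colw_mul r (g : option K -> R) : g None = 0 ->
  \sum_d colw r d * g d = r * (\sum_c g (Some c) / #|K|%:R).
Proof.
move=> g0; rewrite big_option g0 mulr0 add0r mulr_sumr; apply: eq_bigr => c _ /=.
by rewrite mulrAC mulrA.
Qed.

(* McDiarmid's coupling: conditionally on the other coordinates, success
   depends on whether the colour of one element lies in a fixed set, and the
   union bound makes one round of density r at least as good as two rounds. *)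
Lemma two_rounds_le (I : finType) (P : pred I) (S : I -> {set E * K})
    (r1 r2 r : R) : (0 < #|K|)%N ->
  0 <= r1 -> 0 <= r2 -> r1 + r2 <= r -> r <= 1 ->
  (forall i, P i -> {in S i &, injective fst}) ->
  \sum_u \sum_v prodw (colw r1) u * prodw (colw r2) v *
    (hits P S (graph_of u :|: graph_of v))%:R <=
  \sum_W prodw (colw r) W * (hits P S (graph_of W))%:R.
Proof.
move=> K0 r10 r20 r12 r1' Sinj.
pose gr2 (W : {ffun E -> option K * option K}) : {set E * K} :=
  [set x | ((W x.1).1 == Some x.2) || ((W x.1).2 == Some x.2)].
pose f W : R := (hits P S (gr2 W))%:R.
pose nu (d : option K * option K) := colw r1 d.1 * colw r2 d.2.
(* The single round is also written as a law on pairs, with second component forced to [None], so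
   that both sides become product measures on one space. *)
pose nu' (d : option K * option K) := colw r d.1 * (d.2 == None)%:R.
have r01 : 0 <= r1 <= 1 by apply/andP; split => //; lra.
have r02 : 0 <= r2 <= 1 by apply/andP; split => //; lra.
have r0 : 0 <= r <= 1 by apply/andP; split => //; lra.
have sumN (h : option K -> R) : \sum_d h d * (d == None)%:R = h None.
  rewrite (bigD1 None)//= mulr1 big1 ?addr0// => d /negbTE ->.
  by rewrite mulr0.
have sum_nu' (h : option K * option K -> R) :
    \sum_d nu' d * h d = \sum_d1 colw r d1 * h (d1, None).
  transitivity (\sum_d1 \sum_d2 nu' (d1, d2) * h (d1, d2)).
    by rewrite pair_bigA; apply: eq_bigr => -[].
  apply: eq_bigr => d1 _; rewrite -[RHS](sumN (fun d2 => colw r d1 * h (d1, d2))).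
  by apply: eq_bigr => d2 _; rewrite /nu' /= mulrAC.
have sum_nu1 : \sum_d nu d = 1.
  transitivity (\sum_d1 \sum_d2 nu (d1, d2)).
    by rewrite pair_bigA; apply: eq_bigr => -[].
  by under eq_bigr do rewrite /nu -mulr_sumr sum_colw// mulr1; rewrite sum_colw.
suff main : \sum_W prodw nu W * f W <= \sum_W prodw nu' W * f W.
  move: main; rewrite /nu /nu' (sum_prodw_pair (colw r1) (colw r2)).
  rewrite (sum_prodw_pair (colw r) (fun d2 => (d2 == None)%:R)).
  rewrite [X in _ <= X -> _](_ : _ =
    \sum_W prodw (colw r) W * (hits P S (graph_of W))%:R); last first.
    apply: eq_bigr => u _; rewrite (bigD1 [ffun=> None])//= big1 ?addr0.
      rewrite /prodw [X in _ * X * _]big1 ?mulr1; last first.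
        by move=> e _; rewrite ffunE.
      congr (_ * (hits P S _)%:R); apply/setP => x; rewrite !inE !ffunE /=.
      by rewrite orbF.
    move=> v vN; have [e ve] : exists e, v e != None.
      apply/existsP; rewrite -negb_forall; apply: contra vN => /forallP H.
      by apply/eqP/ffunP => e; rewrite ffunE; apply/eqP.
    by rewrite /prodw [X in _ * X * _](bigD1 e)//= (negbTE ve) mul0r mulr0 mul0r.
  apply: le_trans; rewrite le_eqVlt; apply/orP; left; apply/eqP.
  apply: eq_bigr => u _; apply: eq_bigr => v _; congr (_ * (hits P S _)%:R).
  by apply/setP => x; rewrite !inE !ffunE.
apply: prodw_le => [d|d|||W e].
- by rewrite mulr_ge0// colw_ge0.
- by rewrite mulr_ge0 ?colw_ge0.
- exact: sum_nu1.
- rewrite -[RHS](sum_colw r K0); under eq_bigr do rewrite -[nu' _]mulr1.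
  by rewrite sum_nu'; under eq_bigr do rewrite mulr1.
rewrite sum_nu'; pose h d := f (upd W e d).
have hmono d : hits P S (gr2 (upd W e (None, None))) ->
    hits P S (gr2 (upd W e d)).
  by apply: hitsS; apply/subsetP => x; rewrite !inE !ffunE; case: (x.1 == e).
have [h1|h0] := boolP (hits P S (gr2 (upd W e (None, None)))).
  have f1 d : f (upd W e d) = 1 by rewrite /f hmono.
  under eq_bigr do rewrite f1 mulr1.
  under [X in _ <= X]eq_bigr do rewrite f1 mulr1.
  by rewrite sum_colw// sum_nu1.
have hN : h (None, None) = 0 by rewrite /h /f (negbTE h0).
(* Each [S i] has at most one pair over [e], so a hit that needs [e] uses only one of the colours
   [d1], [d2]. *)
have hD d1 d2 : h (d1, d2) <= h (d1, None) + h (d2, None).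
  rewrite /h /f -natrD ler_nat.
  case H: (hits P S (gr2 (upd W e (d1, d2)))) => //.
  have /existsP[i /andP[Pi /subsetP Si]] := H.
  have [/existsP[x /and3P[xS /eqP xe xd1]]|no1] :=
    boolP [exists x, [&& x \in S i, x.1 == e & d1 == Some x.2]].
    rewrite (_ : hits P S (gr2 (upd W e (d1, None))))//.
    apply/existsP; exists i; rewrite Pi; apply/subsetP => y yS.
    have := Si y yS; rewrite !inE !ffunE; case: (eqVneq y.1 e) => //= ye _.
    by rewrite (Sinj i Pi y x)// ?ye ?xe// xd1.
  rewrite (_ : hits P S (gr2 (upd W e (d2, None)))) ?addn1//.
  apply/existsP; exists i; rewrite Pi; apply/subsetP => y yS.
  have := Si y yS; rewrite !inE !ffunE; case: (eqVneq y.1 e) => //= ye /orP[d1y|->//].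
  move: no1; rewrite negb_exists => /forallP /(_ y).
  by rewrite yS ye eqxx d1y.
have -> : \sum_d nu d * f (upd W e d) =
    \sum_d1 \sum_d2 colw r1 d1 * colw r2 d2 * h (d1, d2).
  by rewrite pair_bigA; apply: eq_bigr => -[].
(* By this union bound two rounds give at most [r1 + r2] times the mean of [h (Some c, None)] over
   the colours, while one round gives [r] times it. *)
apply: (@le_trans _ _ (\sum_d1 \sum_d2
    (colw r1 d1 * h (d1, None) * colw r2 d2 +
     colw r1 d1 * (colw r2 d2 * h (d2, None))))).
  apply: ler_sum => d1 _; apply: ler_sum => d2 _.
  apply: (le_trans (ler_wpM2l _ (hD d1 d2))); first by rewrite mulr_ge0 ?colw_ge0.
  by rewrite le_eqVlt; apply/orP; left; apply/eqP; ring.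
under eq_bigr do rewrite big_split /= -!mulr_sumr sum_colw// mulr1.
rewrite big_split /= -mulr_suml sum_colw// mul1r.
rewrite !(sum_colw_mul _ (g := fun d => h (d, None)))// -mulrDl ler_wpM2r//.
by apply: sumr_ge0 => c _; rewrite divr_ge0// /h /f.
Qed.
End PartialColourings.

(** * Minimum fragments *)

Section Fragments.
Variables (R : realFieldType) (E K : finType).

Lemma sum_large_subsets (T : finType) (A : {set T}) (y : R) a : 0 <= y <= 1 ->
  \sum_(B : {set T} | (B \subset A) && (a <= #|B|)%N) y ^+ #|B| <=
  2 ^+ #|A| * y ^+ a.
Proof.
move=> /andP[y0 y1].
apply: (@le_trans _ _ (\sum_(B : {set T} | B \subset A) y ^+ a)).
  rewrite [leRHS](bigID (fun B : {set T} => (a <= #|B|)%N)) /= ler_wpDr//.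
    by apply: sumr_ge0 => B _; rewrite exprn_ge0.
  by apply: ler_sum => B /andP[_ aB]; rewrite ler_wiXn2l.
rewrite (eq_bigl (fun B => B \in powerset A)); last by move=> B; rewrite powersetE.
by rewrite sumr_const card_powerset -natrX mulr_natl.
Qed.

(** At a coordinate of [D], where [Z] carries a colour of weight [r / #|K|], letting [W] vary freely
    replaces that weight by the total mass 1. *)
Lemma sum_agree (r : R) (Z : {ffun E -> option K}) (D : {set E}) :
  (0 < #|K|)%N -> 0 < r -> (forall e, e \in D -> Z e) ->
  \sum_(W : {ffun E -> option K} | [forall (e | e \notin D), W e == Z e])
     prodw (colw r) W = prodw (colw r) Z * (#|K|%:R / r) ^+ #|D|.
Proof.
move=> K0 r0 ZD.
have KR : #|K|%:R != 0 :> R by rewrite pnatr_eq0 -lt0n.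
pose F e d : R := colw r d * ((e \notin D) ==> (d == Z e))%:R.
transitivity (\sum_(W : {ffun E -> option K}) \prod_e F e (W e)).
  rewrite big_mkcond; apply: eq_bigr => W _; case: ifPn => [/forallP H|].
    by apply: eq_bigr => e _; rewrite /F H mulr1.
  rewrite negb_forall => /existsP[e /negbTE eN].
  by rewrite (bigD1 e)//= /F eN mulr0 mul0r.
rewrite -bigA_distr_bigA /=.
transitivity (\prod_e (colw r (Z e) * (if e \in D then #|K|%:R / r else 1))).
  apply: eq_bigr => e _; case: ifPn => eD.
    rewrite /F eD /=; under eq_bigr do rewrite mulr1.
    rewrite sum_colw//; have := ZD e eD; case: (Z e) => // c _ /=.
    by rewrite mulrA divfK// divff ?gt_eqF.
  rewrite (bigD1 (Z e))//= big1 => [|d /negbTE dZ].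
    by rewrite addr0 /F eD eqxx mulr1.
  by rewrite /F eD dZ mulr0.
by rewrite big_split /= -big_mkcond prodr_const.
Qed.

Section Family.
Variables (I : finType) (P : pred I) (S : I -> {set E * K}) (w : I -> R).

(** The minimum fragment of Park and Pham: among the members inside [graph_of W :|: S i], choose one
    with the fewest elements outside [W]. When [P i] holds, the default [i] is itself a
    candidate. *)
Definition frag_index (W : {ffun E -> option K}) (i : I) : I :=
  [arg min_(j < i | P j && (S j \subset graph_of W :|: S i))
     #|S j :\: graph_of W|].

Definition frag W i : {set E * K} := S (frag_index W i) :\: graph_of W.

Lemma frag_indexP W i : P i ->
  [/\ P (frag_index W i), S (frag_index W i) \subset graph_of W :|: S i &
   forall j, P j -> S j \subset graph_of W :|: S i ->
     (#|frag W i| <= #|S j :\: graph_of W|)%N].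
Proof.
move=> Pi; rewrite /frag /frag_index; case: arg_minnP.
  by rewrite Pi subsetUr.
move=> j /andP[Pj Sj] jmin; split=> // l Pl Sl.
by apply: jmin; rewrite Pl.
Qed.

Lemma frag_sub W i : P i -> frag W i \subset S i.
Proof.
move=> /(frag_indexP W)[_ /subsetP sub _]; apply/subsetP => x.
by rewrite inE => /andP[/negbTE xW /sub]; rewrite inE xW.
Qed.

Lemma frag_inj W i : (forall j, P j -> {in S j &, injective fst}) -> P i ->
  {in frag W i &, injective fst}.
Proof.
move=> Sinj /(frag_indexP W)[Pj _ _] x y.
by move=> /setDP[xS _] /setDP[yS _]; apply: Sinj Pj _ _ xS yS.
Qed.

(** A fragment is what the first round misses of some genuine member, so a second round covering the
    fragment completes that member. *)
Lemma hits_frag u v a :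
  hits (fun i => P i && (#|frag u i| < a)%N) (frag u) (graph_of v) ->
  hits P S (graph_of u :|: graph_of v).
Proof.
case/existsP => i /andP[/andP[Pi _] sub]; apply/existsP.
have [Pj _ _] := frag_indexP u Pi; exists (frag_index u i); rewrite Pj.
apply/subsetP => x xS; rewrite inE; case: (boolP (x \in graph_of u)) => //= xu.
by apply: (subsetP sub); rewrite inE xu.
Qed.

(* Overwriting [W] by the fragment gives an outcome [Z] from which a fixed
   member [S j] contained in [Z] can be read off; minimality forces this [S j]
   to contain the fragment, which therefore has few possible values. *)
Lemma frag_encode W i : (forall j, P j -> {in S j &, injective fst}) -> P i ->
  exists Z : {ffun E -> option K},
    [/\ [forall (e | e \notin [set x.1 | x in frag W i]), W e == Z e],
     exists j, P j && (S j \subset graph_of Z) &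
     forall j, P j -> S j \subset graph_of Z -> frag W i \subset S j].
Proof.
move=> Sinj Pi; have [Pj Sj jmin] := frag_indexP W Pi.
set T := frag W i; set j0 := frag_index W i in Pj Sj.
pose Z : {ffun E -> option K} := [ffun e =>
  if [pick x | (x \in T) && (x.1 == e)] is Some x then Some x.2 else W e].
have gZ : graph_of Z \subset graph_of W :|: T.
  apply/subsetP => x; rewrite in_setU !(in_set (fun x => _ == Some x.2)) ffunE.
  case: pickP => [y|_ ->//]; case/andP=> yT /eqP yx /eqP[yx2].
  by rewrite (surjective_pairing x) -yx -yx2 -surjective_pairing yT orbT.
exists Z; split.
- apply/forall_inP => e eT; rewrite ffunE; case: pickP => // x /andP[xT /eqP xe].
  by case/negP: eT; apply/imsetP; exists x.
- exists j0; rewrite Pj; apply/subsetP => x xS; rewrite inE ffunE.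
  case: pickP => [y /andP[yT /eqP yx]|noT].
    have yS : y \in S j0 by move: yT; rewrite inE => /andP[].
    by rewrite (Sinj _ Pj _ _ yS xS yx).
  have := noT x; rewrite eqxx andbT /T /frag inE xS andbT => /negbFE.
  by rewrite inE.
move=> j Pj' SjZ.
(* [S j] competes in the minimisation, so it has at least [#|T|] elements outside [W]. As these lie
   in [T], they are all of [T]. *)
have sub : S j :\: graph_of W \subset T.
  apply/subsetP => x; rewrite inE => /andP[/negbTE xW /(subsetP SjZ)/(subsetP gZ)].
  by rewrite inE xW.
suff /eqP <- : S j :\: graph_of W == T by exact: subsetDl.
rewrite eqEcard sub jmin//; apply: subset_trans SjZ _.
apply: subset_trans gZ _; exact: setUS (frag_sub W Pi).
Qed.

(** Count via the encoding [(Z, T)]: given [Z], the fragment [T] is a subset of one fixed member,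
    hence has at most [2 ^ l] values. Recovering [W] from [Z] costs at most [#|K| / r] per element
    of [T], and spreadness pays [s] per element. *)
Lemma large_frag_le (r s : R) (l a : nat) : (0 < #|K|)%N -> 0 < r -> r <= 1 ->
  0 <= s -> s * #|K|%:R / r <= 1 -> (forall i, 0 <= w i) ->
  (forall i, P i -> {in S i &, injective fst}) ->
  (forall i, P i -> (#|S i| <= l)%N) ->
  (forall A : {set E * K}, \sum_(i | P i && (A \subset S i)) w i <= s ^+ #|A|) ->
  \sum_W prodw (colw r) W * (\sum_(i | P i && (a <= #|frag W i|)%N) w i) <=
  2 ^+ l * (s * #|K|%:R / r) ^+ a.
Proof.
move=> K0 r0 r1 s0 y1 w0 Sinj Sl spr; set y := s * _ / r in y1 *.
have rr : 0 <= r <= 1 by rewrite (ltW r0).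
have KR : 0 < #|K|%:R :> R by rewrite ltr0n.
have r0' := ltW r0; have KR' := ltW KR.
have y0 : 0 <= y by rewrite divr_ge0 ?mulr_ge0.
have P0 W : 0 <= prodw (colw r) W by apply: prodw_ge0 => d; rewrite colw_ge0.
(* A member inside [Z] selected from [Z] alone, independently of [W] and [i]; the default [set0]
   respects the same size bound. *)
pose Sh Z := if [pick j | P j && (S j \subset graph_of Z)] is Some j then S j
             else set0.
have ShZ Z : Sh Z \subset graph_of Z.
  by rewrite /Sh; case: pickP => [j /andP[]|_]; rewrite ?sub0set.
have Shl Z : (#|Sh Z| <= l)%N.
  by rewrite /Sh; case: pickP => [j /andP[/Sl]|_]; rewrite ?cards0.
pose ag (W Z : {ffun E -> option K}) (T : {set E * K}) :=
  [forall (e | e \notin [set x.1 | x in T]), W e == Z e].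
pose ok Z (T : {set E * K}) := (T \subset Sh Z) && (a <= #|T|)%N.
(* Each [(W, i)] with a large fragment is charged to a single [(Z, T)]. Only agreement off [T] and
   [T \subset S i] are remembered, so the sums over [W] and over [i] separate. *)
apply: (@le_trans _ _ (\sum_W \sum_(i | P i) \sum_Z \sum_(T | ok Z T)
    prodw (colw r) W * (ag W Z T)%:R * (w i * (T \subset S i)%:R))).
  apply: ler_sum => W _; rewrite mulr_sumr [leRHS](bigID
    (fun i => (a <= #|frag W i|)%N)) /= ler_wpDr//.
    by do 3!apply: sumr_ge0 => ? _; rewrite !mulr_ge0.
  apply: ler_sum => i /andP[Pi ai].
  have [Z [agZ [j jZ] TZ]] := frag_encode W Sinj Pi.
  have okT : ok Z (frag W i).
    rewrite /ok ai andbT /Sh; case: pickP => [j' /andP[]|/(_ j)]; first exact: TZ.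
    by rewrite jZ.
  rewrite (bigD1 Z)//= (bigD1 (frag W i))//= /ag agZ frag_sub// !mulr1.
  rewrite -addrA ler_wpDr// addr_ge0//; first by apply: sumr_ge0 => ? _; rewrite !mulr_ge0.
  by do 2!apply: sumr_ge0 => ? _; rewrite !mulr_ge0.
have -> : \sum_W \sum_(i | P i) \sum_Z \sum_(T | ok Z T)
    prodw (colw r) W * (ag W Z T)%:R * (w i * (T \subset S i)%:R) =
  \sum_Z \sum_(T | ok Z T) (\sum_(W | ag W Z T) prodw (colw r) W) *
    (\sum_(i | P i && (T \subset S i)) w i).
  under eq_bigr do rewrite exchange_big /=.
  rewrite exchange_big /=; apply: eq_bigr => Z _.
  under eq_bigr do rewrite exchange_big /=.
  rewrite exchange_big /=; apply: eq_bigr => T _.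
  rewrite [in RHS]big_mkcond mulr_suml; apply: eq_bigr => W _.
  rewrite -mulr_sumr; congr (_ * _); first by case: ifP; rewrite ?mulr1 ?mulr0.
  by rewrite big_mkcondr; apply: eq_bigr => i _; case: ifP; rewrite ?mulr1 ?mulr0.
apply: (@le_trans _ _ (\sum_(Z : {ffun E -> option K}) prodw (colw r) Z * (2 ^+ l * y ^+ a))); last first.
  by rewrite -mulr_suml (sum_prodw _ (sum_colw r K0)) mul1r.
apply: ler_sum => Z _.
apply: (@le_trans _ _ (\sum_(T | ok Z T) prodw (colw r) Z * y ^+ #|T|)); last first.
  rewrite -mulr_sumr ler_wpM2l//.
  apply: le_trans (sum_large_subsets _ _ _) _; first by rewrite y0.
  by rewrite ler_wpM2r ?exprn_ge0// ler_weXn2l// ler1n.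
apply: ler_sum => T /andP[TZ _].
have TgZ := subset_trans TZ (ShZ Z).
rewrite sum_agree//; last first.
  by move=> e /imsetP[x /(subsetP TgZ)]; rewrite inE => /eqP xZ ->; rewrite xZ.
have -> : y = s * (#|K|%:R / r) by rewrite /y mulrA.
rewrite -mulrA ler_wpM2l// (exprMn _ s) mulrC.
apply: ler_pM => //; first by apply: sumr_ge0.
  by rewrite exprn_ge0// divr_ge0 ?ltW.
rewrite ler_weXn2l ?leq_imset_card// ler_pdivlMr// mul1r.
by apply: le_trans r1 _; rewrite ler1n.
Qed.

End Family.
End Fragments.

(** * Iterating the rounds *)

Section Threshold.
Variables (R : realFieldType) (E K I : finType) (w : I -> R) (s : R).
Hypotheses (K0 : (0 < #|K|)%N) (w0 : forall i, 0 <= w i) (s0 : 0 < s).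

Let hitprob (r : R) (P : pred I) (S : I -> {set E * K}) : R :=
  \sum_W prodw (colw r) W * (hits P S (graph_of W))%:R.

(** Take threshold 1 in the fragment bound: if no member is covered, every fragment is nonempty, so
    the whole weight counts as large. *)
Lemma last_round (P : pred I) (S : I -> {set E * K}) (r : R) (m : nat) :
  0 < r -> r <= 1 -> s * #|K|%:R / r <= 1 ->
  (forall i, P i -> {in S i &, injective fst}) ->
  (forall i, P i -> (#|S i| <= m)%N) ->
  (forall A : {set E * K}, \sum_(i | P i && (A \subset S i)) w i <= s ^+ #|A|) ->
  \sum_(i | P i) w i - 2 ^+ m * (s * #|K|%:R / r) <= hitprob r P S.
Proof.
move=> r0 r1 y1 Sinj Sm spr.
have rr : 0 <= r <= 1 by rewrite (ltW r0).
have := large_frag_le 1 K0 r0 r1 (ltW s0) y1 w0 Sinj Sm spr.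
rewrite expr1 => le; rewrite lerBlDr -lerBlDl; apply: le_trans le.
rewrite lerBlDl /hitprob -big_split /=.
rewrite -[leLHS]mul1r -[X in X * _ <= _](sum_prodw E (sum_colw r K0)) mulr_suml.
apply: ler_sum => W _; rewrite -mulrDr ler_wpM2l//.
  by apply: prodw_ge0 => d; rewrite colw_ge0.
rewrite (bigID (fun i => (1 <= #|frag P S W i|)%N)) /= addrC lerD2r.
case: (boolP (hits P S (graph_of W))) => [_|noW].
  (* Spreadness at the empty set says that the total weight is at most 1. *)
  have := spr set0; rewrite cards0 expr0; apply: le_trans.
  by apply: ler_sum_subset => // i /andP[->]; rewrite sub0set.
rewrite big1// => i /andP[Pi]; rewrite -eqn0Ngt cards_eq0 => /eqP T0.
case/negP: noW; have [Pj _ _] := frag_indexP S W Pi.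
apply/existsP; exists (frag_index P S W i); rewrite Pj /= -setD_eq0.
exact/eqP.
Qed.

(** Induction on [k]: one round halves the size bound outside a small weight, the indices with large
    fragments are discarded, and the remaining fragments inherit spreadness because each lies in its
    [S i]. The discarded weights form a geometric series summing to
    [2^-1 ^+ m * (1 - 2^-1 ^+ k)]. *)
Lemma spread_threshold (m k : nat) (P : pred I) (S : I -> {set E * K}) (r0 r : R) :
  (0 < m)%N -> 0 < r0 -> s * #|K|%:R / r0 <= 1 ->
  16 * (s * #|K|%:R) * k%:R + r0 <= r -> r <= 1 ->
  (forall i, P i -> {in S i &, injective fst}) ->
  (forall i, P i -> (#|S i| <= 2 ^ k * m)%N) ->
  (forall A : {set E * K}, \sum_(i | P i && (A \subset S i)) w i <= s ^+ #|A|) ->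
  \sum_(i | P i) w i -
    (2 ^+ m * (s * #|K|%:R / r0) + 2^-1 ^+ m * (1 - 2^-1 ^+ k)) <= hitprob r P S.
Proof.
have arith1 h : (4 * h.+1 = 2 * h + (2 * h + 4))%N by lia.
have arith2 h i j : (i <= h -> j <= h -> i + j.+1 <= 2 * h + 4)%N by lia.
move=> m0 r00 y1; have KR : 0 < #|K|%:R :> R by rewrite ltr0n.
have sK : 0 < s * #|K|%:R by rewrite mulr_gt0.
elim: k P S r => [|k IH] P S r rk r1 Sinj Sk spr.
  rewrite expr0 subrr mulr0 addr0; rewrite mulr0 add0r in rk.
  rewrite expn0 mul1n in Sk.
  have r_gt0 : 0 < r by apply: lt_le_trans rk.
  have yle : s * #|K|%:R / r <= s * #|K|%:R / r0.
    by rewrite ler_pM2l// lef_pV2.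
  apply: le_trans (last_round r_gt0 r1 (le_trans yle y1) Sinj Sk spr).
  by rewrite lerD2l lerN2 ler_wpM2l// exprn_ge0.
(* The factor 16 makes the ratio in the fragment bound [2 ^ -4], which beats the [2 ^ (2 * h)]
   subsets of a member. *)
pose r1' := 16 * (s * #|K|%:R); pose r2 := r - r1'.
have k0 : 0 <= r1' * k%:R by rewrite !mulr_ge0// ltW.
have r1'0 : 0 < r1' by rewrite /r1' mulr_gt0.
have r2k : r1' * k%:R + r0 <= r2.
  by move: rk; rewrite -/r1' -natr1 /r2; lra.
have r20 : 0 <= r2 by apply: le_trans r2k; lra.
have r1'1 : r1' <= 1 by rewrite /r2 in r20; lra.
have r21 : r2 <= 1 by rewrite /r2; lra.
have r1'01 : 0 <= r1' <= 1 by rewrite ltW.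
have y16 : s * #|K|%:R / r1' = 16^-1.
  by rewrite /r1' invfM mulrCA divff ?gt_eqF// mulr1.
apply: le_trans (two_rounds_le K0 (ltW r1'0) r20 _ r1 Sinj); last by rewrite /r2; lra.
pose h := (2 ^ k * m)%N.
pose P' W i := P i && (#|frag P S W i| < h.+1)%N.
have step W : \sum_(i | P' W i) w i -
    (2 ^+ m * (s * #|K|%:R / r0) + 2^-1 ^+ m * (1 - 2^-1 ^+ k)) <=
    hitprob r2 (P' W) (frag P S W).
  apply: IH => // [i /andP[Pi _]|i /andP[_]|A].
  - exact: frag_inj.
  - by rewrite ltnS.
  - apply: le_trans (spr A); apply: ler_sum_subset => // i.
    case/andP=> /andP[Pi _] Asub.
    by rewrite Pi (subset_trans Asub)// frag_sub.
have y16' : s * #|K|%:R / r1' <= 1 by rewrite y16; lra.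
have lf := large_frag_le h.+1 K0 r1'0 r1'1 (ltW s0) y16' w0 Sinj Sk spr.
(* What survives is [2 ^ -(2 * h + 4)]; since [h = 2 ^ k * m] is at least both [m] and [k], this is
   below [2 ^ -(m + k + 1)]. *)
have err : 2 ^+ (2 ^ k.+1 * m) * (s * #|K|%:R / r1') ^+ h.+1 <=
    2^-1 ^+ m * 2^-1 ^+ k.+1 :> R.
  rewrite y16 (_ : 16^-1 = 2^-1 ^+ 4 :> R); last by rewrite exprVn; congr _^-1; ring.
  rewrite -exprM -exprD (_ : 4 * h.+1 = 2 ^ k.+1 * m + (2 * h + 4))%N; last first.
    by rewrite expnS -mulnA -/h arith1.
  rewrite exprD mulrA -exprMn divff ?pnatr_eq0// expr1n mul1r.
  apply: ler_wiXn2l; [lra|lra|].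
  have kk : (k < 2 ^ k)%N by rewrite ltn_expl.
  apply: arith2; first by rewrite /h leq_pmull// expn_gt0.
  by rewrite (leq_trans (ltnW kk))// /h leq_pmulr.
apply: (@le_trans _ _ (\sum_u prodw (colw r1') u * hitprob r2 (P' u) (frag P S u)));
  last first.
  apply: ler_sum => u _; rewrite /hitprob mulr_sumr; apply: ler_sum => v _.
  rewrite mulrA ler_wpM2l ?mulr_ge0 ?prodw_ge0// => [d|d|].
  - by rewrite colw_ge0.
  - by rewrite colw_ge0// r20.
  - by rewrite ler_nat; case: hits (@hits_frag _ _ _ P S u v h.+1) => // ->.
pose e := 2 ^+ m * (s * #|K|%:R / r0) + 2^-1 ^+ m * (1 - 2^-1 ^+ k).
apply: (@le_trans _ _ (\sum_u prodw (colw r1') u * (\sum_(i | P' u i) w i - e)));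
  last first.
  by apply: ler_sum => u _; rewrite ler_wpM2l// prodw_ge0// => d; rewrite colw_ge0.
have -> : \sum_u prodw (colw r1') u * (\sum_(i | P' u i) w i - e) =
    \sum_(i | P i) w i - e - \sum_u prodw (colw r1') u *
      (\sum_(i | P i && (h.+1 <= #|frag P S u i|)%N) w i).
  rewrite -[X in _ = X - _]mul1r -[X in _ = X * _ - _](sum_prodw E (sum_colw r1' K0)) mulr_suml.
  rewrite -sumrB; apply: eq_bigr => u _; rewrite -mulrBr; congr (_ * _).
  rewrite [X in _ = X - _ - _](bigID (fun i => (#|frag P S u i| < h.+1)%N)) /=.
  rewrite [X in _ = _ + X - _ - _](eq_bigl (fun i =>
    P i && (h.+1 <= #|frag P S u i|)%N)); last by move=> i; rewrite -leqNgt.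
  by rewrite /P'; ring.
have half : 2^-1 ^+ m * 2^-1 ^+ k = 2^-1 ^+ m * 2^-1 ^+ k.+1 * 2 :> R.
  by rewrite [in RHS]exprS; field.
have half' : 2^-1 ^+ m * (1 - 2^-1 ^+ k) = 2^-1 ^+ m - 2^-1 ^+ m * 2^-1 ^+ k :> R by ring.
have half'' : 2^-1 ^+ m * (1 - 2^-1 ^+ k.+1) = 2^-1 ^+ m - 2^-1 ^+ m * 2^-1 ^+ k.+1 :> R by ring.
rewrite /e half' half''; move: (le_trans lf err) half.
move: (2^-1 ^+ m * 2^-1 ^+ k) (2^-1 ^+ m * 2^-1 ^+ k.+1) => a b; lra.
Qed.

End Threshold.

(** * Bernoulli percolation *)

Section Bernoulli.
Variables (R : realFieldType) (T : finType) (r : R).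

Definition bern (W : {set T}) : R := \prod_e (if e \in W then r else 1 - r).

Lemma bern_ge0 W : 0 <= r <= 1 -> 0 <= bern W.
Proof.
by case/andP=> r0 r1; apply: prodr_ge0 => e _; case: ifP; rewrite ?subr_ge0.
Qed.

Lemma bern_supset (S : {set T}) : \sum_(W : {set T} | S \subset W) bern W = r ^+ #|S|.
Proof.
transitivity (\prod_e (r + (if e \in S then 0 else 1 - r))); last first.
  rewrite (eq_bigr (fun e => if e \in S then r else 1)).
    by rewrite -big_mkcond prodr_const.
  by move=> e _; case: ifP; rewrite ?addr0// addrC subrK.
rewrite bigA_distr big_mkcond /=; apply: eq_bigr => W _; case: ifPn => [SW|].
  apply: eq_bigr => e _; case: ifPn => // eW; case: ifPn => // eS.
  by rewrite (subsetP SW) in eW.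
by case/subsetPn => e eS /negbTE eW; rewrite (bigD1 e)//= eW eS mul0r.
Qed.

Lemma bern_disjoint (S : {set T}) :
  \sum_(W : {set T} | [disjoint S & W]) bern W = (1 - r) ^+ #|S|.
Proof.
transitivity (\prod_e ((if e \in S then 0 else r) + (1 - r))); last first.
  rewrite (eq_bigr (fun e => if e \in S then 1 - r else 1)).
    by rewrite -big_mkcond prodr_const.
  by move=> e _; case: ifP; rewrite ?add0r// addrC subrK.
rewrite bigA_distr big_mkcond /=; apply: eq_bigr => W _; case: ifPn => [SW|].
  apply: eq_bigr => e _; case: ifPn => // eW; case: ifPn => // eS.
  by have := disjointFr SW eS; rewrite eW.
rewrite -setI_eq0 => /set0Pn[e]; rewrite inE => /andP[eS eW].
by rewrite (bigD1 e)//= eW eS mul0r.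
Qed.

Lemma sum_bern : \sum_(W : {set T}) bern W = 1.
Proof.
rewrite -[RHS](expr0 r) -(cards0 T) -bern_supset.
by apply: eq_bigl => W; rewrite sub0set.
Qed.

End Bernoulli.

(* The conditional law of a matching chosen in the percolated set inherits its
   spread from the percolation, at the cost of the conditioning. *)
Lemma percolation_spread (R : realType) (T : finType) (F : {set {set T}}) (r : R) :
  0 < r -> r <= 1 ->
  2^-1 <= \sum_(W : {set T} | [exists M in F, M \subset W]) bern r W ->
  supports_spread (2 * r) F.
Proof.
move=> r0 r1; have r01 : 0 <= r <= 1 by rewrite (ltW r0).
set good := fun W : {set T} => [exists M in F, M \subset W].
set Z := \sum_(W | _) _ => Z2; have Z0 : 0 < Z by apply: lt_le_trans Z2.
(* The default [set0] never enters: every sum below is restricted to [good] sets. *)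
pose pk (W : {set T}) := odflt set0 [pick M in F | M \subset W].
have pkP W : good W -> pk W \in F /\ pk W \subset W.
  move=> /exists_inP[M MF MW]; rewrite /pk; case: pickP => [N /andP[]//|/(_ M)].
  by rewrite MF MW.
pose mu M := (\sum_(W | good W && (pk W == M)) bern r W) / Z.
have muE (Q : pred {set T}) :
    \sum_(M | Q M) mu M = (\sum_(W | good W && Q (pk W)) bern r W) / Z.
  rewrite -mulr_suml; congr (_ / _); rewrite [RHS](partition_big pk Q) /=.
    apply: eq_bigr => M QM; apply: eq_bigl => W.
    by case: eqP => [->|]; rewrite ?QM ?andbF ?andbT.
  by move=> W /andP[].
split; first by rewrite mulr_gt0.
exists mu; split.
- split=> [M|]; first by rewrite divr_ge0 ?(ltW Z0)// sumr_ge0// => W _; rewrite bern_ge0.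
  by rewrite muE; under eq_bigl do rewrite andbT; rewrite divff ?gt_eqF.
- move=> S; rewrite /Prob muE.
  (* Conditioning costs one factor 2, which [(2 * r) ^+ #|S|] absorbs only for nonempty [S]. *)
  have [->|S0] := eqVneq S set0.
    rewrite cards0 expr0 ler_pdivrMr// mul1r; apply: ler_sum_subset.
      by move=> W; rewrite bern_ge0.
    by move=> W /andP[].
  apply: (@le_trans _ _ (2 * r ^+ #|S|)); last first.
    rewrite exprMn ler_wpM2r ?exprn_ge0 ?(ltW r0)// -[leLHS]expr1.
    by rewrite ler_weXn2l ?ler1n// card_gt0.
  rewrite -(bern_supset r S) ler_pdivrMr//.
  apply: (@le_trans _ _ (\sum_(W : {set T} | S \subset W) bern r W)).
    apply: ler_sum_subset => [W|W /andP[gW]]; first by rewrite bern_ge0.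
    by rewrite inE => /subset_trans; apply; case: (pkP W gW).
  have s0 : 0 <= \sum_(W : {set T} | S \subset W) bern r W.
    by apply: sumr_ge0 => W _; rewrite bern_ge0.
  by rewrite mulrAC -[leLHS]mul1r ler_wpM2r//; lra.
- rewrite /Prob muE -[RHS](divff (lt0r_neq0 Z0)); congr (_ / _).
  by apply: eq_bigl => W; apply: andb_idr => gW; have [] := pkP W gW.
Qed.

(** * Colouring a spread measure *)

(** The image of a product measure under a coordinatewise map is the product of the image laws, by
    distributivity over fibres. *)
Lemma sum_prodw_map (R : realFieldType) (E A D : finType) (nu : A -> R)
    (s : A -> D) (g : {ffun E -> D} -> R) :
  \sum_V prodw (fun d => \sum_(a | s a == d) nu a) V * g V =
  \sum_U prodw nu U * g [ffun e => s (U e)].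
Proof.
transitivity (\sum_V \sum_(U : {ffun E -> A} | [ffun e => s (U e)] == V)
    prodw nu U * g V).
  apply: eq_bigr => V _; rewrite -mulr_suml; congr (_ * _).
  rewrite /prodw bigA_distr_big_dep /=; apply: eq_bigl => U.
  apply/familyP/eqP => [H|<- e].
    by apply/ffunP => e; rewrite ffunE; apply/eqP; exact: H e.
  by rewrite unfold_in /= ffunE.
rewrite (exchange_big_dep xpredT) //=; apply: eq_bigr => U _.
by rewrite (big_pred1 [ffun e => s (U e)])// => V.
Qed.

(** Forgetting the colours of discarded edges turns coloured percolation into a random partial
    colouring, as colour and retention are independent at each edge. *)
Lemma colour_percolation_sum (R : realType) (E : finType) (Q : nat) (rho : R)
    (g : {ffun E -> option 'I_Q} -> R) : (0 < Q)%N ->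
  \sum_W prodw (colw rho) W * g W =
  \sum_(x : {ffun E -> 'I_Q} * {set E}) colour_percolation rho x *
    g [ffun e => if e \in x.2 then Some (x.1 e) else None].
Proof.
move=> Qpos.
pose a (c : 'I_Q) : R := Q%:R^-1.
pose b (h : bool) : R := if h then rho else 1 - rho.
pose s (x : 'I_Q * bool) := if x.2 then Some x.1 else None.
have QR : Q%:R != 0 :> R by rewrite pnatr_eq0 -lt0n.
have cw d : colw rho d = \sum_(x | s x == d) a x.1 * b x.2.
  case: d => [c|] /=.
    by rewrite (big_pred1 (c, true)) ?card_ord /= 1?mulrC// => -[c' []] /=;
      rewrite xpair_eqE ?andbT ?andbF.
  rewrite (eq_bigl (fun x => true && ~~ x.2)); last by case=> c [].
  rewrite -(pair_big xpredT (fun h => ~~ h) (fun c h => a c * b h)) /=.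
  under eq_bigr do rewrite big_mkcond big_bool /= add0r /a /b.
  by rewrite sumr_const card_ord -mulrnAl -mulr_natr mulVf// mul1r.
transitivity (\sum_W prodw (fun d => \sum_(x | s x == d) a x.1 * b x.2) W * g W).
  by apply: eq_bigr => W _; congr (_ * _); apply: eq_bigr => e _; rewrite cw.
rewrite sum_prodw_map sum_prodw_pair.
rewrite -(pair_bigA _ (fun u H => colour_percolation rho (u, H) *
  g [ffun e => if e \in H then Some (u e) else None])) /=.
apply: eq_bigr => u _.
rewrite (reindex (fun H : {set E} => [ffun e => e \in H])) /=; last first.
  exists (fun v => [set e | v e]) => [H|v] _.
    by apply/setP => e; rewrite inE ffunE.
  by apply/ffunP => e; rewrite ffunE inE.
apply: eq_bigr => H _; rewrite /colour_percolation /prodw /=; congr (_ * _ * g _).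
  by apply: eq_bigr => e _; rewrite /b ffunE.
by apply/ffunP => e; rewrite !ffunE /s /=.
Qed.

Section Colouring.
Variables (R : realType) (E K : finType) (mu : {set E} -> R) (q : R).
Variables (F : {set {set E}}) (k0 : K).

(** A fixed injection of [M] into the colours once [#|M| <= #|K|]; followed by a uniform permutation
    of [K] it becomes a uniformly random injection. *)
Definition label (M : {set E}) (e : E) : K := nth k0 (enum K) (index e (enum M)).

Lemma label_inj (M : {set E}) : (#|M| <= #|K|)%N -> {in M &, injective (label M)}.
Proof.
move=> MK e f eM fM /eqP; rewrite nth_uniq ?enum_uniq//.
- by move=> /eqP ie; rewrite -[e](@nth_index _ e e (enum M)) ?mem_enum// ie nth_index ?mem_enum.
- by rewrite -cardE; apply: leq_trans MK; rewrite cardE index_mem mem_enum.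
- by rewrite -cardE; apply: leq_trans MK; rewrite cardE index_mem mem_enum.
Qed.

Definition coloured (i : {set E} * {perm K}) : {set E * K} :=
  [set (e, i.2 (label i.1 e)) | e in i.1].

Lemma coloured_inj i : {in coloured i &, injective fst}.
Proof. by move=> x y /imsetP[e _ ->] /imsetP[f _ ->] /= ->. Qed.

Lemma card_coloured i : (#|coloured i| <= #|i.1|)%N.
Proof. exact: leq_imset_card. Qed.

(** Composing with the inverse of [s0] yields permutations fixing [D] pointwise, that is,
    permutations of the complement of [D]. *)
Lemma card_perm_agree (s0 : {perm K}) (D : {set K}) :
  (#|[set s : {perm K} | [forall (d | d \in D), s d == s0 d]]| <= (#|K| - #|D|)`!)%N.
Proof.
have -> : (#|K| - #|D| = #|~: D|)%N by rewrite -(cardsC D) addKn.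
rewrite -card_perm -(card_imset _ (mulIg (s0^-1)%g)).
apply/subset_leq_card/subsetP => _ /imsetP[s + ->]; rewrite inE => /forall_inP sD.
apply/subsetP => d; rewrite !inE; apply: contra => dD.
by rewrite permM (eqP (sD d dD)) permK.
Qed.

(** The falling factorial of [Q] is at least [(Q / e) ^ k]. The induction step rests on
    [(1 + 1 / Q) ^ k <= e ^ (k / Q) <= e]. *)
Lemma expn_fact_ratio (Q k : nat) : (k <= Q)%N ->
  Q%:R ^+ k * ((Q - k)`!)%:R <= expR 1 ^+ k * (Q`!)%:R :> R.
Proof.
have e1 : 1 <= expR 1 :> R by apply: le_trans (expR_ge1Dx 1); rewrite lerDl.
elim: k Q => [|k IH] [|Q]//.
rewrite ltnS subSS => kQ; rewrite factS natrM.
have -> : expR 1 ^+ k.+1 * (Q.+1%:R * Q`!%:R) =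
    Q.+1%:R * (expR 1 * (expR 1 ^+ k * Q`!%:R)) :> R by rewrite exprS; ring.
rewrite exprS -mulrA ler_wpM2l//.
apply: (@le_trans _ _ (expR 1 * (Q%:R ^+ k * ((Q - k)`!)%:R))); last first.
  by rewrite ler_wpM2l ?IH// expR_ge0.
rewrite mulrA ler_wpM2r//.
have [Q0|Qpos] := posnP Q.
  by move: kQ; rewrite Q0 leqn0 => /eqP ->; rewrite !expr0 mulr1.
have QR : 0 < Q%:R :> R by rewrite ltr0n.
have -> : Q.+1%:R = Q%:R * (1 + Q%:R^-1) :> R.
  by rewrite mulrDr mulr1 divff ?gt_eqF// -natr1.
rewrite exprMn mulrC ler_wpM2r ?exprn_ge0//.
apply: (@le_trans _ _ (expR (Q%:R^-1) ^+ k)).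
  by rewrite lerXn2r ?nnegrE ?addr_ge0 ?expR_ge0 ?invr_ge0// expR_ge1Dx.
rewrite -expRM_natl ler_expR.
by rewrite ler_pdivrMr// mul1r ler_nat.
Qed.

Hypotheses (muP : is_pmf mu) (spr : spread q mu) (q0 : 0 < q).
Hypothesis Fcard : forall M, M \in F -> (#|M| <= #|K|)%N.

(** If some coloured matching contains [A], then [A] projects injectively to edges. A matching
    contains that projection with probability at most [q ^+ #|A|]; given it, the permutation is
    prescribed on [#|A|] labels, which has probability at most [(e / #|K|) ^ #|A|]. *)
Lemma coloured_spread (A : {set E * K}) :
  \sum_(i | (i.1 \in F) && (A \subset coloured i)) (mu i.1 / (#|K| `!)%:R) <=
  (expR 1 * q / #|K|%:R) ^+ #|A|.
Proof.
have mu0 := muP.1; have K0 : (0 < #|K|)%N by apply/card_gt0P; exists k0.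
have KR : 0 < #|K|%:R :> R by rewrite ltr0n.
have fK : 0 < (#|K| `!)%:R :> R by rewrite ltr0n fact_gt0.
have y0 : 0 <= expR 1 * q / #|K|%:R by rewrite divr_ge0 ?mulr_ge0 ?expR_ge0 ?ltW.
have [[M0 s0] /andP[/= M0F A0]|none] :=
  pickP (fun i : {set E} * {perm K} => (i.1 \in F) && (A \subset coloured i));
  last first.
  by rewrite big_pred0// exprn_ge0.
pose D := [set x.1 | x in A].
have AD : #|D| = #|A|.
  apply: card_in_imset => x y xA yA.
  exact: coloured_inj (subsetP A0 x xA) (subsetP A0 y yA).
have DM M s : A \subset coloured (M, s) -> D \subset M.
  move=> /subsetP AS; apply/subsetP => _ /imsetP[x /AS + ->].
  by case/imsetP => e eM ->.
have AK : (#|A| <= #|K|)%N.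
  by rewrite -AD; apply: leq_trans (subset_leq_card (DM _ _ A0)) (Fcard M0F).
apply: (@le_trans _ _ (\sum_(M : {set E} | D \subset M) mu M *
   (((#|K| - #|A|)`!)%:R / (#|K| `!)%:R))).
  rewrite -(pair_big_dep (fun M => M \in F) (fun M s => A \subset coloured (M, s))
    (fun M s => mu M / (#|K| `!)%:R)) /=.
  apply: (@le_trans _ _ (\sum_(M | M \in F) (D \subset M)%:R * (mu M *
   (((#|K| - #|A|)`!)%:R / (#|K| `!)%:R)))); last first.
    rewrite big_mkcond [leRHS]big_mkcond; apply: ler_sum => M _.
    by case: (M \in F); case: (D \subset M); rewrite ?mul1r ?mul0r// !mulr_ge0// invr_ge0 ltW.
  apply: ler_sum => M MF.
  have [s1 /= s1A|no] := pickP (fun s => A \subset coloured (M, s)); last first.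
    by rewrite big_pred0// !mulr_ge0// invr_ge0 ltW.
  rewrite (DM _ _ s1A) mul1r sumr_const -(mulr_natr (_ / _)) -mulrA ler_wpM2l// mulrC.
  rewrite ler_pM2r ?invr_gt0// ler_nat.
  (* All permutations whose coloured matching contains [A] agree with [s1] on the labels of the
     edges in [D]. *)
  pose D' := [set label M e | e in D].
  have D'A : #|D'| = #|A|.
    rewrite -AD; apply: card_in_imset => x y xD yD.
    have DMs := subsetP (DM _ _ s1A).
    exact: label_inj (Fcard MF) x y (DMs x xD) (DMs y yD).
  rewrite -D'A; apply: leq_trans (card_perm_agree s1 D').
  apply/subset_leq_card/subsetP => s sA; rewrite inE.
  apply/forall_inP => _ /imsetP[e /imsetP[x xA ->] ->].
  have /imsetP[e1 e1M x1] := subsetP s1A x xA.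
  have /imsetP[e2 e2M x2] := subsetP sA x xA.
  by rewrite x1 /=; move: x2; rewrite x1 => -[<- <-].
rewrite -mulr_suml; have -> : \sum_(M : {set E} | D \subset M) mu M = Prob mu (upset D).
  by rewrite /Prob; apply: eq_bigl => M; rewrite inE.
apply: (@le_trans _ _ (q ^+ #|A| * (((#|K| - #|A|)`!)%:R / (#|K| `!)%:R))).
  by rewrite ler_wpM2r ?divr_ge0// -AD.
rewrite mulrAC exprMn mulrC ler_wpM2r ?exprn_ge0 ?(ltW q0)//.
rewrite ler_pdivrMr// exprMn exprVn mulrAC ler_pdivlMr ?exprn_gt0//.
by rewrite mulrC expn_fact_ratio.
Qed.

Lemma coloured_mass : Prob mu F = 1 ->
  \sum_(i : {set E} * {perm K} | i.1 \in F) (mu i.1 / (#|K| `!)%:R) = 1.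
Proof.
move=> muF; have fK : (#|K| `!)%:R != 0 :> R by rewrite pnatr_eq0 -lt0n fact_gt0.
rewrite (eq_bigl (fun i => (i.1 \in F) && true)); last by move=> i; rewrite andbT.
rewrite -(pair_big (fun M => M \in F) xpredT (fun M (s : {perm K}) => mu M / (#|K| `!)%:R)) /=.
rewrite -[RHS]muF; apply: eq_bigr => M _.
rewrite sumr_const -(mulr_natr (_ / _)) (_ : #|{perm K}| = #|K| `!) ?divfK//.
by rewrite -(cardsT K) -card_perm; apply: eq_card => s; rewrite !inE; apply/esym/subsetP.
Qed.

End Colouring.

(** * Hall's theorem *)

Local Close Scope ring_scope.

(* Rado's proof: if no element could be removed from [N a], two Hall-violating
   sets would contradict submodularity. *)
Lemma hall (T : finType) (U : {set T}) (N : T -> {set T}) :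
  (forall X : {set T}, X \subset U -> #|X| <= #|\bigcup_(a in X) N a|) ->
  exists g : T -> T, {in U &, injective g} /\ (forall a, a \in U -> g a \in N a).
Proof.
have [n] := ubnP (\sum_(a in U) #|N a|); elim: n N => // n IH N ltn hallN.
have [a /andP[aU Na]|N1] := pickP (fun a => (a \in U) && (1 < #|N a|)); last first.
  have N_eq1 a : a \in U -> exists b, N a = [set b].
    move=> aU; apply/cards1P; rewrite eqn_leq.
    have := N1 a; rewrite aU /= ltnNge => /negbFE ->.
    have := hallN [set a]; rewrite big_set1 cards1; apply.
    by rewrite sub1set.
  pose g a := odflt a [pick b in N a].
  have Ng a : a \in U -> N a = [set g a].
    move=> /N_eq1[b Nb]; rewrite /g Nb; case: pickP => [c|/(_ b)]; rewrite inE ?eqxx//.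
    by move=> /eqP ->.
  exists g; split=> [a b aU bU gab|a aU]; last by rewrite Ng ?set11.
  apply/eqP; apply: contraT => ab.
  have := hallN [set a; b]; rewrite subUset !sub1set aU bU cards2 ab => /(_ isT).
  rewrite bigcup_setU !big_set1 !Ng// gab setUid cards1.
  by [].
pose M b x := if x == a then N a :\ b else N x.
have ltM b : b \in N a -> \sum_(x in U) #|M b x| < n.
  move=> bN; rewrite -ltnS; apply: leq_trans ltn; rewrite ltnS.
  rewrite (bigD1 a)//= [X in _ < X](bigD1 a)//= /M eqxx (cardsD1 b (N a)) bN.
  rewrite add1n addSn ltnS leq_add2l; apply: leq_sum => x /andP[_ /negbTE ->] //.
have [b1 b1N] : exists b, b \in N a by apply/card_gt0P; apply: ltnW.
have [b2] : exists b, b \in N a :\ b1.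
  by apply/card_gt0P; move: Na; rewrite (cardsD1 b1) b1N.
rewrite !inE => /andP[b21 b2N].
(* Delete [b] from [N a]: either induction finishes, or Hall's condition breaks. A violating set
   must contain [a], and [Y] is that set without [a]. *)
have try b : b \in N a ->
    (exists g : T -> T, {in U &, injective g} /\ (forall a, a \in U -> g a \in N a)) \/
    exists2 Y : {set T}, a \notin Y /\ a |: Y \subset U &
      #|(\bigcup_(x in Y) N x) :|: (N a :\ b)| <= #|Y|.
  move=> bN.
  have [X /andP[XU Xlt]|ok] := pickP (fun X : {set T} => (X \subset U) &&
    (#|\bigcup_(x in X) M b x| < #|X|)).
    right; have aX : a \in X.
      apply: contraTT Xlt => aX; rewrite -leqNgt; apply: leq_trans (hallN X XU) _.
      rewrite leq_eqVlt; apply/orP; left; apply/eqP; congr #|pred_of_set _|.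
      apply: eq_bigr => x xX.
      by rewrite /M; case: eqP xX aX => // -> ->.
    exists (X :\ a); first by rewrite setD11 setD1K.
    rewrite -ltnS; move: Xlt; rewrite (cardsD1 a X) aX; apply: leq_ltn_trans.
    rewrite (big_setD1 a aX) /= setUC /M eqxx.
    rewrite leq_eqVlt; apply/orP; left; apply/eqP; congr #|pred_of_set (_ :|: _)|.
    by apply: eq_bigr => x; rewrite !inE => /andP[/negbTE ->].
  left; have [X XU|g [ginj gM]] := IH (M b) (ltM b bN).
    by rewrite leqNgt; have := ok X; rewrite XU => /= ->.
  exists g; split=> // x xU; have := gM x xU; rewrite /M; case: eqP => // ->.
  by rewrite inE => /andP[].
case: (try b1 b1N) => // -[Y1 [aY1 Y1U] le1].
case: (try b2 b2N) => // -[Y2 [aY2 Y2U] le2].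
set B1 := _ :|: _ in le1; set B2 := _ :|: _ in le2.
have sub1 (Y Y' : {set T}) : Y \subset Y' ->
    \bigcup_(x in Y) N x \subset \bigcup_(x in Y') N x.
  move=> /subsetP YY'; apply/bigcupsP => x /YY' xY'; exact: bigcup_sup.
(* As [b1] and [b2] differ, the two punctured copies of [N a] together restore [N a], so Hall's
   condition applies with [a] added. *)
have hU : #|Y1 :|: Y2|.+1 <= #|B1 :|: B2|.
  apply: (@leq_trans #|\bigcup_(x in a |: (Y1 :|: Y2)) N x|).
    rewrite -[X in X <= _](_ : #|a |: (Y1 :|: Y2)| = _); last first.
      by rewrite cardsU1 inE negb_or aY1 aY2.
    apply: hallN; rewrite setUUr subUset Y1U; exact: Y2U.
  apply/subset_leq_card; rewrite bigcup_setU big_set1 subUset; apply/andP; split.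
    apply/subsetP => x xN; rewrite !inE xN !andbT.
    by case: (eqVneq x b1) => [->|]; rewrite ?orbT// eq_sym b21 !orbT.
  rewrite bigcup_setU; apply: setUSS; exact: subsetUl.
have hI : #|Y1 :&: Y2| <= #|B1 :&: B2|.
  apply: leq_trans (hallN (Y1 :&: Y2) _) _.
    by apply: subset_trans (subsetIl _ _) (subset_trans (subsetUr _ _) Y1U).
  apply/subset_leq_card; rewrite subsetI.
  by rewrite !(subset_trans (sub1 _ _ _) (subsetUl _ _)) ?subsetIl ?subsetIr.
have := leq_add hU hI; rewrite addSn !cardsUI => /leq_trans /(_ (leq_add le1 le2)).
by rewrite ltnn.
Qed.

Local Open Scope ring_scope.

(** * Bipartition and expansion *)

(* Pair up the vertices and let a fair coin decide, for each pair, which of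
   the two goes to [U]; then bound the degrees by an exponential moment. *)
Lemma balanced_bipartition (R : realFieldType) (T : finType) (N : T -> {set T}) (t : nat) :
  (2 %| #|T|)%N -> (forall v, 4 * t <= #|N v|)%N ->
  2 * #|T|%:R * (2 / 3) ^+ t < 1 :> R ->
  exists2 U : {set T}, #|U| = #|~: U| &
    forall v, (t <= #|N v :&: U|)%N /\ (t <= #|N v :&: ~: U|)%N.
Proof.
move=> T2 degN small; pose m := (#|T| %/ 2)%N.
have cardT : #|{: 'I_m * bool}| = #|T|.
  by rewrite card_prod card_ord card_bool divnK.
(* An arbitrary pairing of the vertices: [h (i, false)] and [h (i, true)] form the pair with index
   [i]. *)
pose h (x : 'I_m * bool) : T := enum_val (cast_ord cardT (enum_rank x)).
pose pr (v : T) : 'I_m * bool := enum_val (cast_ord (esym cardT) (enum_rank v)).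
have hK : cancel h pr by move=> x; rewrite /h /pr enum_valK cast_ordK enum_rankK.
have prK : cancel pr h by move=> x; rewrite /h /pr enum_valK cast_ordKV enum_rankK.
have h_bij : bijective h by exists pr.
pose U (phi : {ffun 'I_m -> bool}) := [set v | (pr v).2 == phi (pr v).1].
have cardU phi : #|U phi| = m.
  rewrite -[RHS]card_ord -(card_imset predT (f := fun i => h (i, phi i))); last first.
    by move=> i j /(can_inj hK)[].
  apply: eq_card => v; rewrite inE; apply/eqP/imsetP => [e|[i _ ->]].
    by exists (pr v).1; rewrite // -e -surjective_pairing prK.
  by rewrite hK.
pose D v b phi := #|[set w in N v | (w \in U phi) == b]|.
(* The pairs are independent. A pair with one vertex in [N v] has mean factor [3 / 4]; if both are
   in [N v], exactly one counts, and [1 / 2 <= (3 / 4) ^ 2]. *)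
have moment v b : \sum_(phi : {ffun 'I_m -> bool}) (2^-1 : R) ^+ D v b phi <= 2 ^+ m * (3 / 4) ^+ (4 * t).
  pose G i (c : bool) : R := \prod_(d : bool)
    (if (h (i, d) \in N v) && ((d == c) == b) then 2^-1 else 1).
  have -> : \sum_(phi : {ffun 'I_m -> bool}) (2^-1 : R) ^+ D v b phi = \sum_(phi : {ffun 'I_m -> bool}) \prod_i G i (phi i).
    apply: eq_bigr => phi _; rewrite /D -prodr_const big_mkcond /=.
    rewrite (reindex h) /=; last exact: onW_bij.
    rewrite (eq_bigr (fun x => (fun i d => if (h (i, d) \in N v) &&
      ((d == phi i) == b) then 2^-1 else 1) x.1 x.2)).
      by rewrite -(pair_bigA _ (fun i d => if (h (i, d) \in N v) &&
        ((d == phi i) == b) then 2^-1 else 1)).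
    by move=> [i d] _; rewrite !inE hK.
  rewrite -bigA_distr_bigA /=.
  apply: (@le_trans _ _ (\prod_(i < m) (2 * \prod_(d : bool)
      (if h (i, d) \in N v then 3 / 4 else 1)))); last first.
    rewrite big_split /= prodr_const card_ord ler_wpM2l ?exprn_ge0//.
    rewrite pair_bigA /= (eq_bigr (fun x => if h x \in N v then 3 / 4 else 1)); last by case.
    rewrite -(reindex h (P := predT) (F := fun w => if w \in N v then 3 / 4 else 1)) /=;
      last exact: onW_bij.
    rewrite -big_mkcond prodr_const; apply: ler_wiXn2l; [lra|lra|exact: degN].
  apply: ler_prod => i _; rewrite /G !big_bool.
  by case: (_ \in N v); case: (_ \in N v); case: (b) => /=; apply/andP; split; lra.
have [[phi ok]|bad] := pselect (exists phi, forall v b, (t <= D v b phi)%N).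
  exists (U phi) => [|v].
    by apply/eqP; rewrite -(eqn_add2l #|U phi|) cardsC addnn cardU -muln2 divnK.
  have := ok v true; have := ok v false; rewrite /D => f1 f2; split.
    by apply: leq_trans f2 _; apply: subset_leq_card; apply/subsetP => w; rewrite !inE eqb_id.
  by apply: leq_trans f1 _; apply: subset_leq_card; apply/subsetP => w; rewrite !inE eqbF_neg.
exfalso; move: small; apply/negP; rewrite -leNgt.
(* Every bipartition is now assumed bad, so some term of each sum exceeds [2 ^ -t]; summing over
   [phi] contradicts the moments. *)
have low phi : (2^-1 : R) ^+ t <= \sum_v \sum_b 2^-1 ^+ D v b phi.
  have [v [b lt]] : exists v b, (D v b phi < t)%N.
    apply: contrapT => no; apply: bad; exists phi => v b; rewrite leqNgt.
    by apply/negP => lt; apply: no; exists v, b.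
  rewrite (bigD1 v)//= (bigD1 b)//= -addrA ler_wpDr//.
    by rewrite addr_ge0 ?sumr_ge0// => *; rewrite ?sumr_ge0// => *; rewrite exprn_ge0.
  by apply: ler_wiXn2l; [lra|lra|exact: ltnW].
have two0 (k : nat) : 0 < (2 : R) ^+ k by rewrite exprn_gt0.
have tot : 2 ^+ m * (2^-1 : R) ^+ t <= #|T|%:R * 2 * (2 ^+ m * (3 / 4) ^+ (4 * t)).
  apply: (@le_trans _ _ (\sum_(phi : {ffun 'I_m -> bool}) \sum_v \sum_b (2^-1 : R) ^+ D v b phi)).
    apply: le_trans (ler_sum _ (fun phi _ => low phi)).
    by rewrite sumr_const card_ffun card_ord card_bool -(mulr_natl (_ ^+ t)) natrX.
  rewrite exchange_big /=; apply: (@le_trans _ _ (\sum_(v : T) \sum_(b : bool)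
    (2 ^+ m * (3 / 4) ^+ (4 * t)))).
    apply: ler_sum => v _; rewrite exchange_big /=; apply: ler_sum => b _; exact: moment.
  by rewrite !sumr_const card_bool -mulrnA -(mulr_natl (_ * _)) natrM (mulrC 2).
have : 1 <= 2 * #|T|%:R * (2 ^+ t * (3 / 4) ^+ (4 * t)) :> R.
  rewrite -(ler_pM2l (two0 m)) mulr1 -(ler_pM2r (x := 2^-1 ^+ t)) ?exprn_gt0 ?invr_gt0//.
  apply: le_trans tot _; rewrite le_eqVlt; apply/orP; left; apply/eqP.
  have e1 : 2 ^+ t * 2^-1 ^+ t = 1 :> R by rewrite -exprMn divff ?expr1n.
  by rewrite -[LHS]mulr1 -[X in _ * X = _]e1; ring.
move/le_trans; apply; rewrite ler_wpM2l ?mulr_ge0//.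
(* Numerically, [2 * (3 / 4) ^ 4 = 81 / 128 <= 2 / 3]. *)
by rewrite exprM -exprMn lerXn2r ?nnegrE//; lra.
Qed.

Section Expansion.
Variables (R : realType) (G : sgraph).

Lemma dir_edgesE (X Y : {set G}) :
  dir_edges X Y = (\sum_(x in X) #|[set w in Y | adj x w]|)%N.
Proof.
rewrite /dir_edges -sum1_card.
under [RHS]eq_bigr do rewrite -sum1_card.
rewrite pair_big_dep /=; apply: eq_bigl => -[x y] /=; by rewrite !inE.
Qed.

Lemma dir_edges_sym (X Y : {set G}) : dir_edges X Y = dir_edges Y X.
Proof.
have sw_inj : injective (fun x : G * G => (x.2, x.1)) by move=> [? ?] [? ?] [-> ->].
rewrite /dir_edges -(card_imset _ sw_inj).
apply: eq_card => -[x y]; apply/imsetP/idP => [[[a b] + [-> ->]]|].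
  by rewrite !inE /= adj_sym => /and3P[-> -> ->].
rewrite inE /= => /and3P[yY xX xy]; exists (y, x) => //.
by rewrite inE /= xX yY adj_sym.
Qed.

(** For small [X], the crossing degrees give many edges into [~: U], and by bijumbledness few of
    them reach [~: U :\: Z], which is no larger than [X]. For large [X], bijumbledness applies
    directly to [X] and [Z]. *)
Lemma expansion (U X Z : {set G}) (p beta c : R) (t : nat) :
  bijumbled G p beta -> 0 < c <= 1 -> #|U| = #|~: U| ->
  beta <= c / 80 * p * #|G|%:R -> c * p * #|G|%:R / 5 <= t%:R ->
  (forall v, t <= #|[set w | adj v w] :&: ~: U|)%N ->
  X \subset U -> Z \subset ~: U ->
  (#|X| <= #|Z|)%N -> (#|~: U| < #|X| + #|Z|)%N ->
  c / 10 * p * #|G|%:R * #|X|%:R <= (dir_edges X Z)%:R.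
Proof.
move=> [/andP[p0 p1] b0 bij] /andP[c0 c1] Uhalf bsmall tbig degU XU ZU XZ UXZ.
have cardG : #|G|%:R = 2 * #|~: U|%:R :> R.
  by rewrite -(cardsC U) Uhalf natrD; ring.
set n := #|G|%:R in cardG bsmall tbig *; set x : R := #|X|%:R; pose z : R := #|Z|%:R.
have n0 : 0 <= n by []. have x0 : 0 <= x by []. have z0 : 0 <= z by [].
have xz : x <= z by rewrite ler_nat.
have xzn : n / 2 <= x + z.
  by rewrite cardG /x /z -natrD mulrC mulrA mulVf// mul1r ler_nat ltnW.
have pn0 : 0 <= p * n by rewrite mulr_ge0// ltW.
have cpn0 : 0 <= c * p * n by rewrite -mulrA mulr_ge0// ltW.
have [small|large] := lerP (20 * x) (c * n).
  pose y : R := #|~: U :\: Z|%:R.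
  have yx : y <= x.
    rewrite ler_nat cardsD (setIidPr ZU) leq_subLR addnC; exact: ltnW.
  have split_e : (dir_edges X (~: U) = dir_edges X Z + dir_edges X (~: U :\: Z))%N.
    rewrite !dir_edgesE -big_split /=; apply: eq_bigr => v _.
    rewrite -(cardsID Z); congr (_ + _)%N; apply: eq_card => w; rewrite !inE.
      case wZ: (w \in Z); rewrite ?andbF ?andbT//=.
      by have := subsetP ZU w wZ; rewrite inE => ->.
    by rewrite andbA.
  have low : x * t%:R <= (dir_edges X (~: U))%:R.
    rewrite -natrM ler_nat dir_edgesE -sum_nat_const; apply: leq_sum => v _.
    apply: leq_trans (degU v) _; apply: subset_leq_card.
    by apply/subsetP => w; rewrite !inE andbC.
  have up : (dir_edges X (~: U :\: Z))%:R <= p * x * y + beta * x.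
    have := bij X (~: U :\: Z); rewrite ler_norml => /andP[_].
    rewrite lerBlDl => /le_trans; apply; rewrite lerD2l ler_wpM2l//.
    rewrite -[leRHS](ger0_norm x0) -sqrtr_sqr ler_wsqrtr//.
    by rewrite expr2 ler_wpM2l.
  move: low; rewrite split_e natrD.
  have h1 : p * x * y <= p * x * (c * n / 20).
    by rewrite ler_wpM2l ?mulr_ge0 ?(ltW p0)//; lra.
  have h2 : beta * x <= c / 80 * p * n * x by rewrite ler_wpM2r.
  have h3 : x * (c * p * n / 5) <= x * t%:R by rewrite ler_wpM2l.
  have h4 : 0 <= x * (c * p * n) by rewrite mulr_ge0.
  move: up h1 h2 h3 h4; move: (x * t%:R) (dir_edges X Z)%:R (dir_edges X _)%:R (p * x * y) (beta * x).
  by move=> *; lra.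
(* Here [x > c * n / 20] and [z >= n / 4] make the jumbledness error at most an eighth of the main
   term [p * x * z]. *)
have z4 : n / 4 <= z by lra.
pose s := Num.sqrt (x * z); have s0 : 0 <= s by exact: sqrtr_ge0.
have s2 : s ^+ 2 = x * z by rewrite sqr_sqrtr// mulr_ge0.
have scn : c * n / 10 <= s.
  rewrite -(ler_pXn2r (n := 2)) ?nnegrE//; last by rewrite !mulr_ge0// ltW.
  rewrite s2.
  have : (c * n / 20) * (n / 4) <= x * z by apply: ler_pM; rewrite ?mulr_ge0 ?(ltW c0)//; lra.
  apply: le_trans.
  have : c * (c * n ^+ 2) <= 1 * (c * n ^+ 2) by rewrite ler_wpM2r// mulr_ge0 ?sqr_ge0// ltW.
  have : 0 <= c * n ^+ 2 by rewrite mulr_ge0 ?sqr_ge0// ltW.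
  rewrite !expr2; lra.
have bs : beta * s <= p * (x * z) / 8.
  apply: (@le_trans _ _ (c / 80 * p * n * s)); first by rewrite ler_wpM2r.
  rewrite -s2 expr2.
  have : p * s * (c * n / 10) <= p * s * s by rewrite ler_wpM2l// mulr_ge0// ltW.
  lra.
have := bij X Z; rewrite -/s ler_norml => /andP[+ _]; rewrite -/x -/z -/s => lo.
have h1 : p * x * (n / 4) <= p * x * z by rewrite ler_wpM2l// mulr_ge0// ltW.
have h2 : c * (p * n * x) <= 1 * (p * n * x) by rewrite ler_wpM2r// mulr_ge0.
have h3 : 0 <= p * n * x by rewrite mulr_ge0.
lra.
Qed.

End Expansion.

(** * Percolated bipartite graphs *)

Lemma sum_subsets (R : realFieldType) (T : finType) (U : {set T}) (a b : R) :
  \sum_(X : {set T} | X \subset U) a ^+ #|X| * b ^+ #|U :\: X| = (a + b) ^+ #|U|.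
Proof.
transitivity (\prod_(e : T) ((if e \in U then a else 0) + (if e \in U then b else 1))).
  rewrite bigA_distr big_mkcond /=; apply: eq_bigr => X _; case: ifPn => [XU|].
    rewrite -!prodr_const big_mkcond [X in _ * X]big_mkcond -big_split /=.
    apply: eq_bigr => e _; rewrite inE; case: (boolP (e \in X)) => [eX|_] /=.
      by rewrite (subsetP XU) // mulr1.
    by rewrite mul1r.
  by case/subsetPn => e eX /negbTE eU; rewrite (bigD1 e)//= eX eU mul0r.
rewrite -prodr_const [RHS]big_mkcond; apply: eq_bigr => e _.
by case: ifP; rewrite ?add0r.
Qed.

Section BipartitePercolation.
Variable G : sgraph.
Implicit Types (U X Z : {set G}) (H : {set edge G}).

Definition between X Z : {set edge G} :=
  [set e | [exists x in X, exists z in Z, val e == [set x; z]]].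

Lemma set2_inj U (x x' z z' : G) : x \in U -> x' \in U -> z \notin U -> z' \notin U ->
  [set x; z] = [set x'; z'] -> x = x' /\ z = z'.
Proof.
move=> xU x'U zU z'U e; split.
  have : x \in [set x'; z'] by rewrite -e set21.
  by rewrite !inE => /orP[/eqP//|/eqP xz]; rewrite -xz xU in z'U.
have : z \in [set x'; z'] by rewrite -e set22.
by rewrite !inE => /orP[/eqP zx|/eqP//]; rewrite zx x'U in zU.
Qed.

(** As [X] and [Z] lie on opposite sides of [U], an edge determines its ordered pair, so nothing is
    counted twice. *)
Lemma card_between U X Z : X \subset U -> Z \subset ~: U ->
  (dir_edges X Z <= #|between X Z|)%N.
Proof.
move=> /subsetP XU /subsetP ZU; rewrite /dir_edges.
set D := [set xy | _].
have DU xy : xy \in D -> [/\ xy.1 \in U, xy.2 \notin U & adj xy.1 xy.2].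
  rewrite inE => /and3P[/XU ? /ZU]; by rewrite inE => ? ?; split.
rewrite -(card_in_imset (f := fun xy : G * G => [set xy.1; xy.2]) (D := D)); last first.
  move=> [x z] [x' z'] /DU[/= xU zU _] /DU[/= x'U z'U _] e.
  by have [-> ->] := set2_inj xU x'U zU z'U e.
rewrite -(card_imset (between X Z) val_inj); apply/subset_leq_card/subsetP => s.
move=> /imsetP[[x z] xzD ->] /=.
have sE : [set x; z] \in edge_set G.
  rewrite inE; apply/existsP; exists x; apply/existsP; exists z.
  by have [_ _ /= ->] := DU _ xzD; rewrite eqxx.
apply/imsetP; exists (Sub [set x; z] sE : edge G); rewrite ?SubK// inE.
move: xzD; rewrite inE /= => /and3P[xX zZ _].
by apply/exists_inP; exists x => //; apply/exists_inP; exists z; rewrite ?SubK.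
Qed.

(** Hall's theorem for the retained edges across [U]. A violating [X], taken with the vertices of
    [~: U] that it does not reach, is the gap. *)
Lemma perfect_matching_or_gap U H : #|U| = #|~: U| ->
  [exists M in perfect_matchings G, M \subset H] \/
  exists X Z, [/\ X \subset U, Z \subset ~: U, (#|~: U| < #|X| + #|Z|)%N &
    [disjoint between X Z & H]].
Proof.
move=> Uhalf; pose N a := [set b in ~: U | [exists e in H, val e == [set a; b]]].
have [X /andP[XU Xlt]|ok] := pickP (fun X : {set G} => (X \subset U) &&
    (#|\bigcup_(a in X) N a| < #|X|)%N).
  right; exists X, (~: U :\: \bigcup_(a in X) N a); split => //.
  - exact: subsetDl.
  - rewrite cardsD (setIidPr _).
      have : (#|\bigcup_(a in X) N a| <= #|~: U|)%N.
        by rewrite -Uhalf (leq_trans (ltnW Xlt))// subset_leq_card.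
      by move=> le; rewrite addnBA// addnC -addnBA ?(ltnW Xlt)// -[ltnLHS]addn0 ltn_add2l subn_gt0.
    apply/bigcupsP => a _; apply/subsetP => b; by rewrite inE => /andP[].
  - rewrite -setI_eq0; apply/eqP/setP => e; rewrite !inE; apply/negP.
    case/andP => /exists_inP[x xX /exists_inP[z zZ /eqP ez]] eH.
    move: zZ; rewrite inE => /andP[/negP zN zU]; apply: zN.
    apply/bigcupP; exists x => //; rewrite inE zU /=.
    by apply/exists_inP; exists e => //; rewrite ez.
left; have [X XU|g [ginj gN]] := @hall G U N.
  by rewrite leqNgt; have := ok X; rewrite XU => /= ->.
have gU a : a \in U -> g a \notin U.
  by move=> /gN; rewrite !inE => /andP[].
have ge a : a \in U -> exists2 e, e \in H & val e = [set a; g a].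
  by move=> /gN; rewrite inE => /andP[_ /exists_inP[e eH /eqP]]; exists e.
(* The equal sizes of the two sides make the injection onto, so every vertex is covered. *)
have gsurj v : v \notin U -> exists2 a, a \in U & v = g a.
  have im : g @: U = ~: U.
    apply/eqP; rewrite eqEcard card_in_imset// Uhalf leqnn andbT.
    by apply/subsetP => _ /imsetP[a aU ->]; rewrite inE gU.
  by move=> vU; apply/imsetP; rewrite im inE.
apply/exists_inP; pose M := [set e in H | [exists a in U, val e == [set a; g a]]].
exists M; last by apply/subsetP => e; rewrite inE => /andP[].
rewrite inE; apply/forallP => v.
have [a aU va] : exists2 a, a \in U & v = a \/ v = g a.
  case: (boolP (v \in U)) => [vU|/gsurj[a aU ->]]; [exists v|exists a] => //.
    by left.
  by right.
have [e eH ea] := ge a aU; apply/cards1P; exists e; apply/setP => f; rewrite !inE.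
apply/andP/eqP => [[/andP[fH /exists_inP[b bU /eqP fb]]]|->]; last first.
  split; last by rewrite ea !inE; case: va => ->; rewrite eqxx ?orbT.
  by rewrite eH; apply/exists_inP; exists a => //; rewrite ea.
rewrite fb !inE => vb; apply: val_inj; rewrite fb ea.
suff -> : b = a by [].
case: va vb => ->.
  by case/orP => /eqP // ab; have := gU b bU; rewrite -ab aU.
case/orP => /eqP ab; first by have := gU a aU; rewrite ab bU.
by apply/esym/ginj.
Qed.

(** Union bound over gaps. By expansion a gap has probability at most [w ^ (2 * k)] with [k] the
    smaller size; the size condition weakens this to a product over vertices, which the binomial
    theorem sums. *)
Lemma random_perfect_matching (R : realType) U (p beta c r w : R) (t : nat) :
  bijumbled G p beta -> 0 < c <= 1 -> 0 <= r <= 1 -> #|U| = #|~: U| ->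
  beta <= c / 80 * p * #|G|%:R -> c * p * #|G|%:R / 5 <= t%:R ->
  (forall v, (t <= #|[set w | adj v w] :&: U|)%N /\
             (t <= #|[set w | adj v w] :&: ~: U|)%N) ->
  w = expR (- (r * (c / 10 * p * #|G|%:R) / 2)) ->
  \sum_(H : {set edge G} | ~~ [exists M in perfect_matchings G, M \subset H])
    bern r H <= 2 * w * (1 + w) ^+ #|G|.
Proof.
move=> bij c01 r01 Uhalf bsmall tbig deg wE.
have w0 : 0 <= w by rewrite wE expR_ge0.
have /andP[c0 _] := c01; have /andP[r0 r1] := r01; have [/andP[p0 _] _ _] := bij.
have w1 : w <= 1.
  by rewrite wE -expR0 ler_expR oppr_le0 !(divr_ge0, mulr_ge0)// ltW.
have Uhalf' : #|~: U| = #|~: ~: U| by rewrite setCK.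
(* If [#|X| <= #|Z|], then [#|~: U :\: Z| < #|X|], so [2 * #|X|] exceeds [#|X| + #|~: U :\: Z|] by
   at least 1: this is the extra [w]. The powers of 1 prepare for [sum_subsets]. *)
have key X Z : X \subset U -> Z \subset ~: U -> (#|~: U| < #|X| + #|Z|)%N ->
    (1 - r) ^+ #|between X Z| <=
    w * (w ^+ #|X| * 1 ^+ #|U :\: X| * (1 ^+ #|Z| * w ^+ #|~: U :\: Z|) +
         1 ^+ #|X| * w ^+ #|U :\: X| * (w ^+ #|Z| * 1 ^+ #|~: U :\: Z|)).
  move=> XU ZU XZ; rewrite !expr1n !mulr1 !mul1r.
  have bound k : c / 10 * p * #|G|%:R * k%:R <= (dir_edges X Z)%:R ->
      (1 - r) ^+ #|between X Z| <= w ^+ (2 * k).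
    move=> ek; apply: (@le_trans _ _ (expR (- r) ^+ dir_edges X Z)).
      apply: (@le_trans _ _ ((1 - r) ^+ dir_edges X Z)).
        by apply: ler_wiXn2l; [lra|lra|exact: card_between XU ZU].
      by rewrite lerXn2r ?nnegrE ?subr_ge0 ?expR_ge0// expR_ge1Dx.
    rewrite wE -!expRM_natl ler_expR natrM.
    have : r * (c / 10 * p * #|G|%:R * k%:R) <= r * (dir_edges X Z)%:R.
      by rewrite ler_wpM2l.
    lra.
  have cZ : #|~: U :\: Z| = (#|~: U| - #|Z|)%N by rewrite cardsD (setIidPr ZU).
  have cX : #|U :\: X| = (#|~: U| - #|X|)%N by rewrite cardsD (setIidPr XU) Uhalf.
  have lX : (#|X| <= #|~: U|)%N by rewrite -Uhalf subset_leq_card.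
  have lZ : (#|Z| <= #|~: U|)%N by rewrite subset_leq_card.
  case: (leqP #|X| #|Z|) => [le|/ltnW le].
    have ex := expansion bij c01 Uhalf bsmall tbig (fun v => (deg v).2) XU ZU le XZ.
    apply: le_trans (bound _ ex) _.
    apply: (@le_trans _ _ (w * (w ^+ #|X| * w ^+ #|~: U :\: Z|))).
      rewrite -exprD -exprS; apply: ler_wiXn2l => //.
      by rewrite mul2n -addnn -addnS leq_add2l cZ ltn_subLR// addnC.
    by rewrite ler_wpM2l// lerDl mulr_ge0// exprn_ge0.
  have deg' v : (t <= #|[set w | adj v w] :&: ~: ~: U|)%N by rewrite setCK; exact: (deg v).1.
  have XU' : X \subset ~: ~: U by rewrite setCK.
  have XZ' : (#|~: ~: U| < #|Z| + #|X|)%N by rewrite -Uhalf' addnC.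
  have ex := expansion bij c01 Uhalf' bsmall tbig deg' ZU XU' le XZ'.
  rewrite dir_edges_sym in ex; apply: le_trans (bound _ ex) _.
  apply: (@le_trans _ _ (w * (w ^+ #|U :\: X| * w ^+ #|Z|))).
    rewrite -exprD -exprS; apply: ler_wiXn2l => //.
    by rewrite mul2n -addnn -addSn leq_add2r cX ltn_subLR.
  by rewrite ler_wpM2l// lerDr mulr_ge0// exprn_ge0.
apply: (@le_trans _ _ (\sum_(H : {set edge G}) \sum_(X : {set G} | X \subset U)
   \sum_(Z : {set G} | (Z \subset ~: U) && (#|~: U| < #|X| + #|Z|)%N)
     (if [disjoint between X Z & H] then bern r H else 0))).
  rewrite big_mkcond; apply: ler_sum => H _.
  have nn X Z : 0 <= (if [disjoint between X Z & H] then bern r H else 0).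
    by case: ifP => // _; rewrite bern_ge0.
  case: ifPn => [noM|_]; last by rewrite !sumr_ge0// => X _; rewrite sumr_ge0.
  have [yes|[X [Z [XU ZU XZ dis]]]] := perfect_matching_or_gap H Uhalf.
    by rewrite yes in noM.
  rewrite (bigD1 X)//= (bigD1 Z) /=; last by rewrite ZU.
  rewrite dis -addrA ler_wpDr// addr_ge0 ?sumr_ge0// => Y _.
  by rewrite sumr_ge0.
rewrite exchange_big /=.
under eq_bigr do rewrite exchange_big /=.
apply: (@le_trans _ _ (\sum_(X : {set G} | X \subset U) \sum_(Z : {set G} | Z \subset ~: U)
    w * (w ^+ #|X| * 1 ^+ #|U :\: X| * (1 ^+ #|Z| * w ^+ #|~: U :\: Z|) +
         1 ^+ #|X| * w ^+ #|U :\: X| * (w ^+ #|Z| * 1 ^+ #|~: U :\: Z|)))).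
  apply: ler_sum => X XU; rewrite big_mkcondr /=; apply: ler_sum => Z ZU.
  case: ifPn => [XZ|_]; last by rewrite !(mulr_ge0, addr_ge0, exprn_ge0).
  by rewrite -big_mkcond /= bern_disjoint; apply: key.
under eq_bigr do rewrite -mulr_sumr big_split /= -!mulr_sumr sum_subsets sum_subsets.
rewrite -mulr_sumr big_split /= -!mulr_suml !sum_subsets (addrC w 1).
rewrite -!exprD -(cardsC U) le_eqVlt; apply/orP; left; apply/eqP; ring.
Qed.

End BipartitePercolation.

(** * Bounds for admissible graphs *)

Section Main.
Variable R : realType.

Lemma expR1_le4 : expR 1 <= 4 :> R.
Proof.
have h : 2^-1 <= expR (- 2^-1) :> R by have := @expR_ge1Dx R (- 2^-1); lra.
have e : expR 1 * (expR (- 2^-1) * expR (- 2^-1)) = 1 :> R.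
  by rewrite -!expRD (_ : 1 + (_ + _) = 0) ?expR0//; lra.
have e0 : 0 < expR 1 :> R by exact: expR_gt0.
have : expR 1 * (2^-1 * 2^-1) <= expR 1 * (expR (- 2^-1) * expR (- 2^-1)) :> R.
  by rewrite ler_pM2l// ler_pM.
by rewrite e; lra.
Qed.

Lemma ln_ge_half (n : nat) : (1 < n)%N -> 2^-1 <= ln n%:R :> R.
Proof.
move=> n1; have n0 : 0 < n%:R :> R by rewrite ltr0n ltnW.
rewrite -ler_expR lnK ?posrE//.
have h : 2^-1 <= expR (- 2^-1) :> R by have := @expR_ge1Dx R (- 2^-1); lra.
apply: (@le_trans _ _ 2); last by rewrite (ler_nat _ 2).
have e : expR (2^-1) * expR (- 2^-1) = 1 :> R by rewrite -expRD subrr expR0.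
have e0 : 0 < expR (2^-1) :> R by exact: expR_gt0.
have : expR (2^-1) * 2^-1 <= expR (2^-1) * expR (- 2^-1) :> R by rewrite ler_pM2l.
by rewrite e; lra.
Qed.

Lemma expRN_ln (n k : nat) : (0 < n)%N ->
  expR (- (k%:R * ln n%:R)) = n%:R^-1 ^+ k :> R.
Proof.
move=> n0; rewrite -mulrN expRM_natl expRN lnK// posrE ltr0n//.
Qed.

Lemma min_degree_le (G : sgraph) (v : G) : (min_degree G <= degree v)%N.
Proof.
rewrite /min_degree; elim: (index_enum G) (mem_index_enum v) => // a s IH.
by rewrite inE big_cons geq_min => /orP[/eqP->|/IH ->]; rewrite ?leqnn ?orbT.
Qed.

Lemma spreadS (T : finType) (q q' : R) (F : {set {set T}}) :
  q <= q' -> supports_spread q F -> supports_spread q' F.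
Proof.
move=> qq' [q0 [mu [pmf spr muF]]]; split; first exact: lt_le_trans qq'.
exists mu; split=> // S; apply: le_trans (spr S) _.
by rewrite lerXn2r// nnegrE ltW// (lt_le_trans q0).
Qed.

Section Numerics.
Variables (c C gamma : R) (G : sgraph) (p beta rho : R).
Hypotheses (c01 : 0 < c <= 1) (Cbig : 160 / c <= C) (gsmall : gamma <= c / 80).
Hypothesis adm : admissible c C gamma G p beta rho.
Local Notation n := #|G|.
Local Notation L := (ln n%:R : R).
Local Notation D := (p * n%:R : R).

Lemma adm_n : (1 < n)%N.
Proof. by have [n0 n2 _ _ _] := adm; case: n n0 n2 => [|[]]. Qed.

Lemma adm_D : 160 * L ^+ 2 <= c * D /\ 0 < D.
Proof.
have /andP[c0 _] := c01; have [n0 n2 [/andP[p0 p1] _ _] /andP[r0 r1] [_ _ rD]] := adm.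
have D0 : 0 < D by rewrite mulr_gt0// ltr0n.
split=> //; have : C * L ^+ 2 <= D.
  by apply: le_trans rD _; rewrite -mulrA -[leRHS]mul1r ler_wpM2r// ltW.
have : (160 / c) * L ^+ 2 <= C * L ^+ 2 by rewrite ler_wpM2r// sqr_ge0.
move=> /le_trans h /h; rewrite mulrAC ler_pdivrMr// => {}h.
by rewrite [leRHS]mulrC.
Qed.

Lemma perfect_matchings_spread :
  supports_spread (160 / c * L / D) (perfect_matchings G).
Proof.
have /andP[c0 c1] := c01; have n1 := adm_n; have [DL D0] := adm_D.
have [n0 n2 bij rho01 [cmin bsmall _]] := adm.
have [/andP[p0 _] b0 _] := bij.
have L2 := ln_ge_half n1.
have LL : 2^-1 * L <= L ^+ 2 by rewrite expr2 ler_wpM2r//; lra.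
have L4 : 4^-1 <= L ^+ 2.
  have : 2^-1 * 2^-1 <= 2^-1 * L by rewrite ler_wpM2l.
  lra.
pose t := (min_degree G %/ 4)%N.
have tdeg v : (4 * t <= #|[set w : G | adj v w]|)%N.
  by apply: leq_trans (min_degree_le v); rewrite mulnC leq_divM.
have tbig : c * p * n%:R / 5 <= t%:R.
  have : (min_degree G)%:R <= 4 * t%:R + 3 :> R.
    rewrite -natrM -natrD ler_nat {1}(divn_eq (min_degree G) 4) -/t mulnC leq_add2l.
    by rewrite -ltnS ltn_mod.
  by rewrite -mulrA in cmin *; lra.
have nR : 2 <= n%:R :> R by rewrite (ler_nat _ 2).
have ninv : n%:R^-1 <= 2^-1 :> R by rewrite lef_pV2 ?posrE//; lra.
have nn1 : n%:R * n%:R^-1 = 1 :> R by rewrite divff// pnatr_eq0 -lt0n.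
have ninv0 : 0 <= n%:R^-1 :> R by rewrite invr_ge0.
have small : 2 * n%:R * (2 / 3) ^+ t < 1 :> R.
  (* [(2 / 3) ^ t <= e ^ (- t / 3)], and [t >= c * D / 5 >= 16 * L]. *)
  have t23 : (2 / 3) ^+ t <= n%:R^-1 ^+ 3 :> R.
    apply: (@le_trans _ _ (expR (- 3^-1) ^+ t)).
      rewrite lerXn2r ?nnegrE ?expR_ge0//.
      by have := @expR_ge1Dx R (- 3^-1); lra.
    by rewrite -expRN_ln// -expRM_natl ler_expR; rewrite -mulrA in tbig; lra.
  apply: (@le_lt_trans _ _ (2 * n%:R * n%:R^-1 ^+ 3)).
    by rewrite ler_wpM2l// mulr_ge0.
  rewrite exprS mulrA -[2 * _ * _]mulrA nn1 mulr1.
  have : n%:R^-1 ^+ 2 <= 2^-1 ^+ 2 :> R by rewrite lerXn2r ?nnegrE.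
  rewrite [2^-1 ^+ 2]expr2; lra.
have [U Uhalf Udeg] := balanced_bipartition n2 tdeg small.
(* Chosen so that the weight [w] of the union bound is exactly [n ^ -4]. *)
pose r := 80 / c * L / D.
have r0 : 0 < r by rewrite divr_gt0// mulr_gt0 ?divr_gt0//; lra.
have r1 : r <= 1.
  by rewrite /r ler_pdivrMr// mul1r mulrAC ler_pdivrMr// [D * c]mulrC; lra.
have -> : 160 / c * L / D = 2 * r by rewrite /r; lra.
apply: percolation_spread => //.
have bs : beta <= c / 80 * p * n%:R.
  by apply: le_trans bsmall _; rewrite -mulrA -[leRHS]mulrA ler_wpM2r// ltW.
have r01 : 0 <= r <= 1 by rewrite ltW.
have wE : n%:R^-1 ^+ 4 = expR (- (r * (c / 10 * p * n%:R) / 2)) :> R.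
  rewrite -expRN_ln//; congr (expR (- _)); rewrite /r.
  have p0' := lt0r_neq0 p0; have c0' := lt0r_neq0 c0.
  have n0' : n%:R != 0 :> R by rewrite pnatr_eq0 -lt0n.
  by field; rewrite c0' p0' n0'.
have := random_perfect_matching bij c01 r01 Uhalf bs tbig Udeg wE.
rewrite -(ler_nat R) in n1; set w := n%:R^-1 ^+ 4 => fail.
have := sum_bern (edge G) r; rewrite (bigID (fun H : {set edge G} =>
  [exists M in perfect_matchings G, M \subset H])) /=.
(* Since [n >= 2], [w <= 1 / 16]; since [n * w <= 1], [(1 + w) ^ n <= e <= 4]. *)
suff : 2 * w * (1 + w) ^+ n <= 2^-1 by move: fail; lra.
have w0 : 0 <= w by rewrite exprn_ge0.
have n3 : n%:R^-1 ^+ 3 <= 1 :> R by rewrite exprn_ile1//; lra.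
have nw : n%:R * w <= 1 by rewrite /w exprS mulrA nn1 mul1r.
have w16 : w <= 16^-1.
  have -> : 16^-1 = 2^-1 ^+ 4 :> R by rewrite exprVn; congr _^-1; ring.
  by rewrite lerXn2r ?nnegrE.
have up : (1 + w) ^+ n <= 4.
  apply: le_trans expR1_le4; apply: (@le_trans _ _ (expR w ^+ n)).
    by rewrite lerXn2r ?nnegrE ?addr_ge0 ?expR_ge0 ?expR_ge1Dx.
  by rewrite -expRM_natl ler_expR.
have : 2 * w * (1 + w) ^+ n <= 2 * 16^-1 * 4.
  by apply: ler_pM; rewrite ?mulr_ge0 ?exprn_ge0 ?addr_ge0//; lra.
lra.
Qed.

Lemma card_perfect_matching (M : {set edge G}) :
  perfect_matching M -> (#|M| <= n./2)%N.
Proof.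
move=> /forallP Mpm.
have card2 (e : edge G) : #|val e| = 2.
  have := valP e; rewrite inE => /existsP[x /existsP[y /andP[xy /eqP ->]]].
  by rewrite cards2; case: eqP xy => // ->; rewrite adj_irr.
have -> : (#|M| <= n./2)%N = (\sum_(e in M) #|val e| <= #|G|)%N.
  by rewrite geq_half_double -muln2 -sum_nat_const; under [in RHS]eq_bigr do rewrite card2.
rewrite -[leqRHS]sum1_card; under eq_bigr do rewrite -sum1_card.
rewrite (exchange_big_dep xpredT) //=.
apply: leq_sum => v _; rewrite sum1_card -[leqRHS](eqP (Mpm v)).
by apply/subset_leq_card/subsetP => e; rewrite !inE.
Qed.

Hypothesis Cbig' : 512 * (160 / c) <= C.

Lemma rainbow_perfect_matching_prob (m : nat) : (0 < m)%N ->
  1 - (2 ^+ m / (64 * L) + 2^-1 ^+ m) <=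
  Prob (@colour_percolation R (edge G) n./2 rho) (has_rainbow_pm G n./2).
Proof.
move=> m0; have /andP[c0 c1] := c01; have n1 := adm_n; have [DL D0] := adm_D.
have [n0 n2 bij /andP[rho0 rho1] [cmin bsmall rhobig]] := adm.
have L2 := ln_ge_half n1.
pose Q := n./2; have Q0 : (0 < Q)%N by rewrite half_gt0.
have QK : #|'I_Q| = Q by rewrite card_ord.
have KQ : (0 < #|'I_Q|)%N by rewrite QK.
have [q0 [mu [pmf spr muF]]] := perfect_matchings_spread.
set q := 160 / c * L / D in q0 spr.
pose k0 : 'I_Q := Ordinal Q0.
have Fcard M : M \in perfect_matchings G -> (#|M| <= #|'I_Q|)%N.
  by rewrite QK inE; apply: card_perfect_matching.
have cspr := coloured_spread k0 pmf spr q0 Fcard.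
have mass := coloured_mass 'I_Q muF.
set s := expR 1 * q / _ in cspr.
have QR : 0 < #|'I_Q|%:R :> R by rewrite ltr0n.
have s0 : 0 < s by rewrite divr_gt0// mulr_gt0 ?expR_gt0.
have sK : s * #|'I_Q|%:R = expR 1 * q by rewrite divfK// gt_eqF.
pose P (i : {set edge G} * {perm 'I_Q}) := i.1 \in perfect_matchings G.
pose w (i : {set edge G} * {perm 'I_Q}) := mu i.1 / (#|'I_Q| `!)%:R.
have w0 i : 0 <= w i by rewrite divr_ge0//; exact: pmf.1.
(* Then [2 ^ k > n], so [k] halvings suffice for any perfect matching, while [k] stays below
   [4 * L]. *)
pose k := (trunc_log 2 n).+1.
have kL : k%:R <= 4 * L.
  have : (trunc_log 2 n)%:R * 2^-1 <= L.
    apply: (@le_trans _ _ ((trunc_log 2 n)%:R * ln 2)).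
      by rewrite ler_wpM2l// (ln_ge_half (n := 2)).
    rewrite mulrC mulr_natr -lnXn// -natrX ler_ln ?posrE ?ltr0n ?expn_gt0//.
    by rewrite ler_nat trunc_logP.
  have -> : k%:R = (trunc_log 2 n)%:R + 1 :> R by rewrite natr1.
  lra.
have qL : 512 * (q * L) <= rho.
  rewrite /q; have : 512 * (160 / c) * L ^+ 2 <= rho * D.
    apply: le_trans (_ : C * L ^+ 2 <= _); last by rewrite mulrA.
    by rewrite ler_wpM2r// sqr_ge0.
  rewrite -ler_pdivrMr//; apply: le_trans; rewrite le_eqVlt.
  by apply/orP; left; apply/eqP; ring.
have e4 := expR1_le4.
have qL0 : 0 < q * L by rewrite mulr_gt0//; lra.
have r00 : 0 < 256 * (q * L) by rewrite pmulr_rgt0// ltr0n.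
have y1 : s * #|'I_Q|%:R / (256 * (q * L)) <= (64 * L)^-1.
  have L0 : 0 < L by lra.
  rewrite sK ler_pdivrMr// -ler_pdivrMl ?invr_gt0 ?mulr_gt0// invrK.
  have : q * L * expR 1 <= q * L * 4 by rewrite ler_wpM2l// ltW.
  lra.
have y1' : s * #|'I_Q|%:R / (256 * (q * L)) <= 1.
  by apply: le_trans y1 _; rewrite invf_le1; lra.
(* The density [rho >= 512 * (q * L)] is split evenly: the halving rounds use at most
   [16 * 4 * 4 * (q * L)], leaving [256 * (q * L)] for the last round. *)
have rk : 16 * (s * #|'I_Q|%:R) * k%:R + 256 * (q * L) <= rho.
  rewrite sK; have eq4 : expR 1 * q <= 4 * q by rewrite ler_wpM2r// ltW.
  have eq0 : 0 <= expR 1 * q by rewrite mulr_ge0 ?expR_ge0// ltW.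
  have : expR 1 * q * k%:R <= 4 * q * (4 * L) by apply: ler_pM.
  lra.
have Sk i : P i -> (#|coloured k0 i| <= 2 ^ k * m)%N.
  move=> Pi; apply: leq_trans (card_coloured _ _) _; apply: leq_trans (Fcard _ Pi) _.
  rewrite QK; apply: (@leq_trans (2 ^ k)); last by rewrite leq_pmulr.
  apply: (@leq_trans n); last by rewrite ltnW// trunc_log_ltn.
  by rewrite /Q -divn2 leq_div.
have main := spread_threshold (P := P) (S := coloured k0) KQ w0 s0 m0 r00 y1' rk rho1
  (fun i _ => @coloured_inj _ _ k0 i) Sk cspr.
rewrite mass colour_percolation_sum// in main.
apply: (@le_trans _ _ (\sum_(x : {ffun edge G -> 'I_Q} * {set edge G})
    colour_percolation rho x * (hits P (coloured k0) (graph_of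
       [ffun e => if e \in x.2 then Some (x.1 e) else None]))%:R)).
  apply: le_trans main; rewrite lerD2l lerN2; apply: lerD.
    by rewrite ler_wpM2l// exprn_ge0.
  by rewrite -[leRHS]mulr1 ler_wpM2l ?exprn_ge0//.
have [cp0 _] := @colour_percolation_pmf R (edge G) Q rho Q0 (introT andP (conj (ltW rho0) rho1)).
rewrite /Prob [leRHS]big_mkcond; apply: ler_sum => -[chi H] _.
case: (boolP (hits _ _ _)) => [|_]; last by rewrite mulr0; case: ifP.
(* A covered coloured matching has all its edges retained, and their actual colours are those given
   by the injective labelling, hence distinct. *)
rewrite mulr1; case/existsP => -[M sg] /andP[PM /subsetP sub].
rewrite ifT // inE; apply/existsP; exists M.
have MH e : e \in M -> e \in H /\ chi e = sg (label k0 M e).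
  move=> eM; have inS : (e, sg (label k0 M e)) \in coloured k0 (M, sg).
    by apply/imsetP; exists e.
  by have := sub _ inS; rewrite inE ffunE /=; case: ifP => // _ /eqP[].
apply/and3P; split; first by move: PM; rewrite /P inE.
  by apply/subsetP => e /MH[].
apply/forall_inP => e eM; apply/forall_inP => f fM; apply/implyP => /= /eqP ef.
have sgef : sg (label k0 M e) = sg (label k0 M f).
  by rewrite -(MH e eM).2 -(MH f fM).2.
exact/eqP/(label_inj (Fcard _ PM) eM fM)/(perm_inj sgef).
Qed.

End Numerics.
End Main.

(** * Choice of the constants and passage to the limit *)

Import numFieldNormedType.Exports.

Local Open Scope classical_set_scope.
Local Open Scope ring_scope.

Theorem theorem1p16 (R : realType) (c : R) (hc : 0 < c) :
  exists C gamma : R, [/\ 0 < C, 0 < gamma,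
    (forall (G : sgraph) (p beta rho : R),
      admissible c C gamma G p beta rho ->
      supports_spread (C * ln #|G|%:R / (p * #|G|%:R)) (perfect_matchings G)) &
    (forall (G : nat -> sgraph) (p beta rho : nat -> R),
      (fun k => #|G k|) @ \oo --> \oo ->
      (forall k, admissible c C gamma (G k) (p k) (beta k) (rho k)) ->
      (fun k => Prob (@colour_percolation R (edge (G k)) (#|G k|./2) (rho k))
                     (has_rainbow_pm (G k) (#|G k|./2))) @ \oo --> (1 : R))].
Proof.
(* The bounds above need [c <= 1], and lowering [c] only weakens the degree hypothesis. *)
pose d := Num.min c 1; pose C := 512 * (160 / d).
have d0 : 0 < d by rewrite lt_min hc ltr01.
have d01 : 0 < d <= 1 by rewrite d0 ge_min lexx orbT.
have C1 : 160 / d <= C by rewrite ler_peMl ?divr_ge0 ?(ltW d0)//; lra.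
have admd G p beta rho : admissible c C (d / 80) G p beta rho ->
    admissible d C (d / 80) G p beta rho.
  case=> n0 n2 bij rho01 [cmin bsmall rhobig]; split=> //; split=> //.
  have [/andP[p0 _] _ _] := bij; apply: le_trans cmin.
  by rewrite -!mulrA ler_wpM2r ?mulr_ge0 ?(ltW p0)// ge_min lexx.
exists C, (d / 80); split.
- by rewrite !pmulr_rgt0 ?invr_gt0 ?ltr0n.
- by rewrite pmulr_rgt0 ?invr_gt0 ?ltr0n.
- move=> G p beta rho /admd adm.
  apply: spreadS (perfect_matchings_spread d01 C1 (lexx _) adm).
  have [_ D0] := adm_D d01 C1 adm; have L0 := ln_ge_half R (adm_n adm).
  by rewrite ler_pM2r ?invr_gt0// ler_pM2r//; lra.
move=> G p beta rho Goo adm; apply/cvgrPdist_le => e e0.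
(* First [m] is fixed so that [2 ^ -m <= e / 2]; then [N] is taken so large that [ln N] makes
   [2 ^ m / (64 * L)] at most [e / 2] as well. *)
pose m := Num.bound (2 / e); pose N := Num.bound (expR (2 ^+ m / (32 * e))).
have e2 : 0 <= 2 / e by rewrite divr_ge0// ltW.
have m_gt : 2 / e < m%:R by exact: archi_boundP.
have m0 : (0 < m)%N by rewrite -(ltr_nat R); apply: le_lt_trans m_gt.
have half_m : 2^-1 ^+ m <= e / 2.
  rewrite exprVn -[e / 2]invrK lef_pV2 ?posrE ?invr_gt0 ?divr_gt0 ?exprn_gt0//.
  rewrite invf_div; apply: le_trans (ltW m_gt) _.
  by rewrite -natrX ler_nat ltnW// ltn_expl.
near=> k.
have Nk : (N <= #|G k|)%N by near: k; move/cvgnyPge : Goo; exact.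
have [n0 n2 _ /andP[rho0 rho1] _] := adm k.
have n1 := adm_n (adm k); have L2 := ln_ge_half R n1.
have L_ge : 2 ^+ m / (32 * e) <= ln #|G k|%:R.
  rewrite -ler_expR lnK ?posrE ?ltr0n//.
  have := archi_boundP (expR_ge0 (2 ^+ m / (32 * e))); rewrite -/N => /ltW/le_trans.
  by apply; rewrite ler_nat.
have Q0 : (0 < #|G k|./2)%N by rewrite half_gt0.
have [cp0 cp1] := @colour_percolation_pmf R (edge (G k)) _ _ Q0
  (introT andP (conj (ltW rho0) rho1)).
have le1 : Prob (@colour_percolation R (edge (G k)) (#|G k|./2) (rho k))
    (has_rainbow_pm (G k) (#|G k|./2)) <= 1.
  by rewrite -cp1; apply: ler_sum_subset.
have := rainbow_perfect_matching_prob d01 C1 (lexx _) (admd _ _ _ _ (adm k)) (lexx _) m0.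
rewrite ger0_norm ?subr_ge0// => low.
suff : 2 ^+ m / (64 * ln #|G k|%:R) <= e / 2 by lra.
rewrite ler_pdivrMr; last by rewrite mulr_gt0//; lra.
move: L_ge; rewrite ler_pdivrMr ?mulr_gt0//; lra.
Unshelve. all: by end_near.
Qed.
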